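(* Let $n\ge0$ be an integer and let $z\in\mathbb{C}$ with $|z|\le1$. Then $${}_2F_1\bigl(\tfrac12,\tfrac12+n;\tfrac32+n;z\bigr)=\frac{1+2n}{4^{n}z^{n+1/2}}\Biggl[\binom{2n}{n}\arcsin\sqrt z+(-1)^n\sum_{\substack{0\le k\le 2n\\ k\ne n}}(-1)^k\binom{2n}{k}\frac{\sin[2(n-k)\arcsin\sqrt z]}{2(n-k)}\Biggr],$$ $${}_2F_1\bigl(\tfrac12,1+n;2+n;z\bigr)=(-1)^{1+n}\frac{1+n}{4^{n}z^{1+n}}\sum_{k=0}^{1+2n}(-1)^k\binom{1+2n}{k}\frac{\cos[(2n-2k+1)\arcsin\sqrt z]-1}{2n-2k+1},$$ and the following two identities hold: $$\sum_{k=0}^{1+2n}(-1)^k\binom{1+2n}{k}\frac{\sin[(2n-2k+1)\arcsin\sqrt z]}{2n-2k+1}=0,$$ $$\sum_{\substack{0\le k\le 2n\\ k\ne n}}(-1)^k\binom{2n}{k}\frac{1-\cos[2(n-k)\arcsin\sqrt z]}{n-k}=0.$$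
   Context: The Gauss hypergeometric function is ${}_2F_1(a,b;c;z)=\sum_{m=0}^{\infty}\frac{(a)_m(b)_m}{(c)_m}\frac{z^m}{m!}$, where $(a)_0=1$ and $(a)_m=a(a+1)\dotsm(a+m-1)$ for $m\ge1$; the two series in the claim converge for $|z|\le1$. Square root, $\arcsin$ and non-integer powers are principal branches, so $z^{n+1/2}=(\sqrt z)^{2n+1}$. At $z=0$ the right-hand sides of the first two formulas are understood as their limits as $z\to0$ (removable singularities). Empty sums are $0$. *)

(* Defs.v *)
From Stdlib Require Import Reals Factorial.
From Coquelicot Require Import Coquelicot.

Open Scope C_scope.

Definition Cexp (z : C) : C :=
  RtoC (exp (Re z)) * (RtoC (cos (Im z)) + Ci * RtoC (sin (Im z))).

Definition Csin (z : C) : C := (Cexp (Ci * z) - Cexp (- (Ci * z))) / (2 * Ci).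
Definition Ccos (z : C) : C := (Cexp (Ci * z) + Cexp (- (Ci * z))) / 2.

(* Principal argument, with values in (-PI, PI]; the value at 0 is irrelevant. *)
Definition Carg (z : C) : R :=
  if Rle_dec 0 (Im z) then acos (Re z / Cmod z) else Ropp (acos (Re z / Cmod z)).

(* Principal logarithm; meaningful for z <> 0 only. *)
Definition Clog (z : C) : C := RtoC (ln (Cmod z)) + Ci * RtoC (Carg z).

(* Principal square root: r e^(i t) |-> sqrt r * e^(i t / 2) for -PI < t <= PI;
   in particular the square root of 0 is 0. *)
Definition Csqrt (z : C) : C :=
  RtoC (sqrt (Cmod z)) * Cexp (Ci * RtoC (Carg z / 2)).

(* Principal arcsine, -i Log (i w + sqrt (1 - w^2)); the argument of the
   logarithm never vanishes. *)
Definition Carcsin (w : C) : C := - Ci * Clog (Ci * w + Csqrt (1 - w ^ 2)).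

Fixpoint pochhammer (a : C) (m : nat) : C :=
  match m with
  | O => 1
  | S m' => pochhammer a m' * (a + INR m')
  end.

Definition hyp2F1_term (a b c z : C) (m : nat) : C :=
  pochhammer a m * pochhammer b m / pochhammer c m * (z ^ m / INR (fact m)).

Definition hyp2F1_cv (a b c z : C) : Prop :=
  @ex_series C_AbsRing C_NormedModule (hyp2F1_term a b c z).

(* Coquelicot's [Series] is real-valued, hence the componentwise sum; it is the
   sum of the complex series whenever [hyp2F1_cv] holds, see [hyp2F1_unique]. *)
Definition hyp2F1 (a b c z : C) : C :=
  (Series (fun m => Re (hyp2F1_term a b c z m)),
   Series (fun m => Im (hyp2F1_term a b c z m))).

Lemma hyp2F1_unique (a b c z l : C) :
  @is_series C_AbsRing C_NormedModule (hyp2F1_term a b c z) l ->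
  hyp2F1 a b c z = l.
Proof.
intros H; unfold is_series in H; unfold hyp2F1.
set (u := hyp2F1_term a b c z) in *.
assert (Hre : forall n, fst (@sum_n C_AbelianMonoid u n) = sum_n (fun m => Re (u m)) n).
{ induction n as [|n IH]; [now rewrite !sum_O | now rewrite !sum_Sn, <- IH]. }
assert (Him : forall n, snd (@sum_n C_AbelianMonoid u n) = sum_n (fun m => Im (u m)) n).
{ induction n as [|n IH]; [now rewrite !sum_O | now rewrite !sum_Sn, <- IH]. }
destruct l as [l1 l2]; f_equal; apply is_series_unique; intros P [eps HP].
- destruct (H (fun x => ball l1 eps (fst x))) as [N HN].
  { exists eps; intros y [Hy _]; exact Hy. }
  exists N; intros n Hn; apply HP; rewrite <- Hre; exact (HN n Hn).
- destruct (H (fun x => ball l2 eps (snd x))) as [N HN].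
  { exists eps; intros y [_ Hy]; exact Hy. }
  exists N; intros n Hn; apply HP; rewrite <- Him; exact (HN n Hn).
Qed.

(* [l] is the value at [z] of [f], where [f] has a removable singularity at 0:
   at z = 0 the (junk) value [f 0] is replaced by the limit of [f]. *)
Definition is_value_rem0 (f : C -> C) (z l : C) : Prop :=
  (z <> 0 -> l = f z) /\
  (z = 0 -> filterlim f (locally' (RtoC 0)) (locally l)).

(* The sum of f k over 0 <= k <= N. *)
Definition Csum (f : nat -> C) (N : nat) : C := @sum_n C_AbelianMonoid f N.

(* The sum of f k over 0 <= k <= N with k <> j. *)
Definition Csum_except (f : nat -> C) (N j : nat) : C :=
  Csum (fun k => if Nat.eqb k j then RtoC 0 else f k) N.

Definition Cbinom (n k : nat) : C := RtoC (Binomial.C n k).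

(* Main.v *)
(* With a_m = (1/2)_m / m! one has 2F1(1/2, b; b+1; z) = b sum_m a_m z^m / (m + b), so, with
   z = w^2 and e = 2 b, the number w^e / e times this value is the integral of
   u^(e-1) / sqrt (1 - u^2) along the segment from 0 to w.  On the ray u = t w, 0 <= t < 1,
   everything is a power series in the real variable t: the series for e = 1 is the arcsine
   (its exponential satisfies a linear differential equation), and substituting
   u = sin theta reduces the general case to the Fourier expansion of sin^(e-1), which is
   integrated term by term.  Abel's theorem gives t = 1, hence also |z| = 1.  The two
   vanishing sums are antisymmetric under k -> N - k. *)

Require Import Defs.
From Stdlib Require Import Reals Lra Lia Factorial.
From Coquelicot Require Import Coquelicot.
Open Scope C_scope.

(** * Complex-valued functions of a real variable *)

(** The coefficients a_m decay only like m^(-1/2), so on |z| = 1 absolute convergence holds for the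
    series with a_m / (m + b), but not for the one with a_m that appears in its derivative.
    Differential equations are therefore available only for t < 1; each identity is proved on [0, 1)
    and passed to t = 1 by one-sided limits, so no division by 1 - w^2, which vanishes at w = 1 and
    w = -1, occurs at the endpoint. A ray keeps the variable real: only derivatives of real and
    imaginary parts occur, and a function with zero derivative being constant replaces integration.
    The branch of the arcsine is settled by size. The partial sums of a_m / (m + 1) telescope below
    2, which gives |Re arcsin| <= 2, while two logarithms of one number differ by multiples of 2 PI
    and 2 + PI < 2 PI. Half of the same bound gives Re sqrt(1 - w^2) >= 0. The limits of the
    right-hand sides at z = 0 are never computed: off 0 they agree with the hypergeometric function,
    which is Lipschitz at 0. *)

Lemma C_ext (x y : C) : Re x = Re y -> Im x = Im y -> x = y.
Proof. destruct x, y; simpl; intros -> ->; reflexivity. Qed.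

Lemma RtoC_neq (x y : R) : x <> y -> RtoC x <> RtoC y.
Proof. intros H E; apply H; exact (RtoC_inj _ _ E). Qed.

Lemma Ci2 : Ci * Ci = -1.
Proof. apply C_ext; simpl; ring. Qed.

Lemma Cexp_0 : Cexp 0 = 1.
Proof. unfold Cexp; simpl; rewrite exp_0, cos_0, sin_0; apply C_ext; simpl; ring. Qed.

Lemma Cexp_plus (x y : C) : Cexp (x + y) = Cexp x * Cexp y.
Proof.
unfold Cexp; destruct x as [a b], y as [c d]; simpl.
rewrite exp_plus, cos_plus, sin_plus; apply C_ext; simpl; ring.
Qed.

Lemma Cexp_opp_l (x : C) : Cexp (- x) * Cexp x = 1.
Proof. rewrite <- Cexp_plus, <- Cexp_0; f_equal; ring. Qed.

Lemma Cexp_neq_0 (x : C) : Cexp x <> 0.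
Proof.
intros H; generalize (Cexp_opp_l x); rewrite H, Cmult_0_r.
intros E; exact (C1_nz (eq_sym E)).
Qed.

Lemma Cexp_INR_mult (m : nat) (x : C) : Cexp (INR m * x) = Cexp x ^ m.
Proof.
induction m as [|m IH].
- simpl; rewrite Cmult_0_l; exact Cexp_0.
- rewrite S_INR, RtoC_plus, Cpow_S, <- IH, <- Cexp_plus; f_equal; ring.
Qed.

Lemma Csin_0 : Csin 0 = 0.
Proof.
unfold Csin; replace (- (Ci * 0)) with (Ci * 0) by ring.
unfold Cdiv, Cminus; rewrite Cplus_opp_r; ring.
Qed.

Lemma Ccos_0 : Ccos 0 = 1.
Proof.
unfold Ccos; replace (- (Ci * 0)) with (RtoC 0) by ring.
rewrite Cmult_0_r, Cexp_0; field.
Qed.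

Lemma Csin_opp (x : C) : Csin (- x) = - Csin x.
Proof.
unfold Csin; replace (- (Ci * - x)) with (Ci * x) by ring.
replace (Ci * - x) with (- (Ci * x)) by ring; field; exact Ci_nz.
Qed.

Lemma Ccos_opp (x : C) : Ccos (- x) = Ccos x.
Proof.
unfold Ccos; replace (- (Ci * - x)) with (Ci * x) by ring.
replace (Ci * - x) with (- (Ci * x)) by ring; field.
Qed.

Lemma Cexp_Ccos_Csin (x : C) : Cexp (Ci * x) = Ccos x + Ci * Csin x.
Proof. unfold Ccos, Csin; field; exact Ci_nz. Qed.

Lemma is_derive_eq (f : R -> R) (t l l' : R) :
  is_derive f t l -> l = l' -> is_derive f t l'.
Proof. intros H <-; exact H. Qed.

(** Componentwise, so that the rules for real derivatives apply directly; no derivative in a complex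
    variable is ever taken. *)
Definition is_Cderive (f : R -> C) (t : R) (l : C) : Prop :=
  is_derive (fun s => Re (f s)) t (Re l) /\ is_derive (fun s => Im (f s)) t (Im l).

Lemma is_Cderive_eq (f : R -> C) (t : R) (l l' : C) :
  is_Cderive f t l -> l = l' -> is_Cderive f t l'.
Proof. intros H <-; exact H. Qed.

Lemma is_Cderive_ext (f g : R -> C) (t : R) (l : C) :
  (forall s, f s = g s) -> is_Cderive f t l -> is_Cderive g t l.
Proof.
intros E [H1 H2]; split.
- refine (is_derive_ext _ _ _ _ _ H1); intros s; now rewrite E.
- refine (is_derive_ext _ _ _ _ _ H2); intros s; now rewrite E.
Qed.

Lemma is_Cderive_const (c : C) (t : R) : is_Cderive (fun _ => c) t 0.
Proof.
split; [exact (is_derive_const (V := R_NormedModule) (Re c) t)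
      | exact (is_derive_const (V := R_NormedModule) (Im c) t)].
Qed.

Lemma is_Cderive_RtoC (f : R -> R) (t l : R) :
  is_derive f t l -> is_Cderive (fun s => RtoC (f s)) t l.
Proof. intros H; split; [exact H | exact (is_derive_const (V := R_NormedModule) 0%R t)]. Qed.

Lemma is_Cderive_plus (f g : R -> C) (t : R) (df dg : C) :
  is_Cderive f t df -> is_Cderive g t dg ->
  is_Cderive (fun s => f s + g s) t (df + dg).
Proof.
intros [F1 F2] [G1 G2]; split.
- exact (is_derive_plus _ _ _ _ _ F1 G1).
- exact (is_derive_plus _ _ _ _ _ F2 G2).
Qed.

Lemma is_Cderive_mult (f g : R -> C) (t : R) (df dg : C) :
  is_Cderive f t df -> is_Cderive g t dg ->
  is_Cderive (fun s => f s * g s) t (df * g t + f t * dg).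
Proof.
intros [F1 F2] [G1 G2]; split.
- eapply is_derive_eq.
  + exact (is_derive_minus _ _ _ _ _ (Derive.is_derive_mult _ _ _ _ _ F1 G1)
      (Derive.is_derive_mult _ _ _ _ _ F2 G2)).
  + unfold minus, plus, opp; simpl; unfold Re, Im; ring.
- eapply is_derive_eq.
  + exact (is_derive_plus _ _ _ _ _ (Derive.is_derive_mult _ _ _ _ _ F1 G2)
      (Derive.is_derive_mult _ _ _ _ _ F2 G1)).
  + unfold plus; simpl; unfold Re, Im; ring.
Qed.

Lemma is_Cderive_scal (c : C) (f : R -> C) (t : R) (df : C) :
  is_Cderive f t df -> is_Cderive (fun s => c * f s) t (c * df).
Proof.
intros H; eapply is_Cderive_eq;
  [exact (is_Cderive_mult _ _ _ _ _ (is_Cderive_const c t) H) | simpl; ring].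
Qed.

Lemma is_Cderive_opp (f : R -> C) (t : R) (df : C) :
  is_Cderive f t df -> is_Cderive (fun s => - f s) t (- df).
Proof.
intros [H1 H2]; split; [exact (is_derive_opp _ _ _ H1) | exact (is_derive_opp _ _ _ H2)].
Qed.

Lemma is_Cderive_minus (f g : R -> C) (t : R) (df dg : C) :
  is_Cderive f t df -> is_Cderive g t dg ->
  is_Cderive (fun s => f s - g s) t (df - dg).
Proof. intros F G; exact (is_Cderive_plus _ _ _ _ _ F (is_Cderive_opp _ _ _ G)). Qed.

Lemma is_Cderive_comp (f : R -> C) (g : R -> R) (t : R) (df : C) (dg : R) :
  is_Cderive f (g t) df -> is_derive g t dg ->
  is_Cderive (fun s => f (g s)) t (dg * df).
Proof.
intros [F1 F2] G; split; eapply is_derive_eq.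
- exact (is_derive_comp _ _ _ _ _ F1 G).
- unfold scal; simpl; unfold mult, Re, Im; simpl; ring.
- exact (is_derive_comp _ _ _ _ _ F2 G).
- unfold scal; simpl; unfold mult, Re, Im; simpl; ring.
Qed.

Lemma is_Cderive_exp (f : R -> C) (t : R) (df : C) :
  is_Cderive f t df -> is_Cderive (fun s => Cexp (f s)) t (df * Cexp (f t)).
Proof.
intros [F1 F2]; unfold Cexp.
eapply is_Cderive_eq.
- apply is_Cderive_mult.
  + apply is_Cderive_RtoC; apply (is_derive_comp exp); [apply is_derive_exp | exact F1].
  + apply is_Cderive_plus.
    * apply is_Cderive_RtoC; apply (is_derive_comp cos); [apply is_derive_cos | exact F2].
    * apply is_Cderive_scal, is_Cderive_RtoC.
      apply (is_derive_comp sin); [apply is_derive_sin | exact F2].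
- unfold scal; simpl; unfold mult; simpl; apply C_ext; unfold Re, Im; simpl; ring.
Qed.

Lemma is_Cderive_sin (f : R -> C) (t : R) (df : C) :
  is_Cderive f t df -> is_Cderive (fun s => Csin (f s)) t (df * Ccos (f t)).
Proof.
intros F.
apply (is_Cderive_ext
  (fun s => / (2 * Ci) * (Cexp (Ci * f s) - Cexp (- (Ci * f s))))).
{ intros s; unfold Csin, Cdiv; ring. }
eapply is_Cderive_eq.
- apply is_Cderive_scal, is_Cderive_minus.
  + apply is_Cderive_exp, is_Cderive_scal, F.
  + apply is_Cderive_exp, is_Cderive_opp, is_Cderive_scal, F.
- unfold Ccos; field; exact Ci_nz.
Qed.

Lemma is_Cderive_cos (f : R -> C) (t : R) (df : C) :
  is_Cderive f t df -> is_Cderive (fun s => Ccos (f s)) t (- (df * Csin (f t))).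
Proof.
intros F.
apply (is_Cderive_ext
  (fun s => / 2 * (Cexp (Ci * f s) + Cexp (- (Ci * f s))))).
{ intros s; unfold Ccos, Cdiv; ring. }
eapply is_Cderive_eq.
- apply is_Cderive_scal, is_Cderive_plus.
  + apply is_Cderive_exp, is_Cderive_scal, F.
  + apply is_Cderive_exp, is_Cderive_opp, is_Cderive_scal, F.
- unfold Csin.
  replace (/ 2 * (Ci * df * Cexp (Ci * f t) + - (Ci * df) * Cexp (- (Ci * f t))))
    with (- (Ci * Ci * df * (Cexp (- (Ci * f t)) - Cexp (Ci * f t)) / (2 * Ci)))
    by (field; exact Ci_nz).
  rewrite Ci2; field; exact Ci_nz.
Qed.

(** The substitute for integration: applied to a difference it identifies two primitives, applied to
    a product or quotient it proves a closed form. *)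
Lemma Cderive_0_const (f : R -> C) (t : R) :
  (0 <= t)%R -> (forall s, (0 <= s <= t)%R -> is_Cderive f s 0) -> f t = f 0%R.
Proof.
intros [Ht | <-] H; [ | reflexivity].
symmetry; apply C_ext.
- apply (eq_is_derive (fun s => Re (f s))); [apply H | exact Ht].
- apply (eq_is_derive (fun s => Im (f s))); [apply H | exact Ht].
Qed.

(** * Finite complex sums and the binomial theorem *)

Lemma Csum_O (f : nat -> C) : Csum f 0 = f 0%nat.
Proof. exact (sum_O (G := C_AbelianMonoid) f). Qed.

Lemma Csum_S (f : nat -> C) (N : nat) : Csum f (S N) = Csum f N + f (S N).
Proof. exact (sum_Sn (G := C_AbelianMonoid) f N). Qed.

Lemma Csum_ext (f g : nat -> C) (N : nat) :
  (forall k, (k <= N)%nat -> f k = g k) -> Csum f N = Csum g N.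
Proof. exact (sum_n_ext_loc (G := C_AbelianMonoid) f g N). Qed.

Lemma Csum_plus (f g : nat -> C) (N : nat) :
  Csum (fun k => f k + g k) N = Csum f N + Csum g N.
Proof.
induction N as [|N IH]; [now rewrite !Csum_O | rewrite !Csum_S, IH; ring].
Qed.

Lemma Csum_scal (c : C) (f : nat -> C) (N : nat) :
  Csum (fun k => c * f k) N = c * Csum f N.
Proof.
induction N as [|N IH]; [now rewrite !Csum_O | rewrite !Csum_S, IH; ring].
Qed.

Lemma Csum_0 (N : nat) : Csum (fun _ => 0) N = 0.
Proof.
induction N as [|N IH]; [now rewrite !Csum_O | rewrite !Csum_S, IH; ring].
Qed.

Lemma Csum_S_l (f : nat -> C) (N : nat) : Csum f (S N) = f 0%nat + Csum (fun k => f (S k)) N.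
Proof.
induction N as [|N IH].
- now rewrite Csum_S, !Csum_O.
- rewrite Csum_S, IH, Csum_S; ring.
Qed.

Lemma Csum_rev (f : nat -> C) (N : nat) : Csum (fun k => f (N - k)%nat) N = Csum f N.
Proof.
induction N as [|N IH]; [now rewrite !Csum_O | ].
rewrite Csum_S_l, Csum_S, <- IH; simpl; ring.
Qed.

Lemma Csum_antisym (f : nat -> C) (N : nat) :
  (forall k, (k <= N)%nat -> f (N - k)%nat = - f k) -> Csum f N = 0.
Proof.
intros H.
assert (E : Csum f N = -1 * Csum f N).
{ rewrite <- (Csum_rev f N) at 1; rewrite <- Csum_scal; apply Csum_ext.
  intros k Hk; rewrite H by exact Hk; ring. }
assert (E2 : 2 * Csum f N = 0).
{ replace (2 * Csum f N) with (Csum f N - -1 * Csum f N) by ring.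
  rewrite <- E; ring. }
replace (Csum f N) with (/ 2 * (2 * Csum f N)) by field.
rewrite E2; ring.
Qed.

Lemma is_Cderive_Csum (f : nat -> R -> C) (df : nat -> C) (t : R) (N : nat) :
  (forall k, (k <= N)%nat -> is_Cderive (f k) t (df k)) ->
  is_Cderive (fun s => Csum (fun k => f k s) N) t (Csum df N).
Proof.
induction N as [|N IH]; intros H.
- rewrite Csum_O; apply (is_Cderive_ext (f 0%nat)); [intros s; now rewrite Csum_O | ].
  apply H; lia.
- rewrite Csum_S.
  apply (is_Cderive_ext (fun s => Csum (fun k => f k s) N + f (S N) s)).
  { intros s; now rewrite Csum_S. }
  apply is_Cderive_plus; [apply IH; intros k Hk | ]; apply H; lia.
Qed.

Lemma Cbinom_sym (N k : nat) : (k <= N)%nat -> Cbinom N (N - k) = Cbinom N k.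
Proof. intros H; unfold Cbinom; f_equal; symmetry; apply pascal_step1; exact H. Qed.

Lemma Cbinom_N_0 (N : nat) : Cbinom N 0 = 1.
Proof.
unfold Cbinom, Binomial.C; f_equal; rewrite Nat.sub_0_r; simpl.
field; apply INR_fact_neq_0.
Qed.

Lemma Cbinom_N_N (N : nat) : Cbinom N N = 1.
Proof. rewrite <- (Cbinom_N_0 N), <- Cbinom_sym by lia; f_equal; lia. Qed.

Lemma Cbinomial (x y : C) (N : nat) :
  (x + y) ^ N = Csum (fun k => Cbinom N k * x ^ (N - k) * y ^ k) N.
Proof.
induction N as [|N IH].
- rewrite Csum_O, Cbinom_N_0; simpl; ring.
- rewrite Cpow_S, IH, Csum_S_l.
  (* Pascal's rule handles the inner indices only; both end terms are split off, and the exponent 1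
     has no inner index. *)
  destruct N as [|N].
  { rewrite !Csum_O, !Cbinom_N_0, Cbinom_N_N; simpl; ring. }
  rewrite Cmult_plus_distr_r, <- !Csum_scal.
  rewrite (Csum_S_l (fun k => x * _)), (Csum_S (fun k => y * _)).
  rewrite (Csum_S _ N), !Cbinom_N_0, !Cbinom_N_N.
  rewrite (Csum_ext (fun k => Cbinom (S (S N)) (S k) * x ^ (S (S N) - S k) * y ^ S k)
    (fun k => x * (Cbinom (S N) (S k) * x ^ (S N - S k) * y ^ S k)
              + y * (Cbinom (S N) k * x ^ (S N - k) * y ^ k))).
  + rewrite Csum_plus, !Nat.sub_diag, !Nat.sub_0_r, !Cpow_S; simpl; ring.
  + intros k Hk; unfold Cbinom.
    rewrite <- (pascal (S N) k) by lia; rewrite RtoC_plus.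
    replace (S (S N) - S k)%nat with (S (S N - S k)) by lia.
    replace (S N - k)%nat with (S (S N - S k)) by lia.
    rewrite !Cpow_S; ring.
Qed.

(** * Fourier expansion of powers of the sine *)

Lemma Cpow_m1_double (n : nat) : (-1) ^ (2 * n) = 1.
Proof.
rewrite Cpow_mult_r; replace ((-1) ^ 2) with (RtoC 1); [apply Cpow_1_l | ].
simpl; ring.
Qed.

Lemma Cpow_m1_sub (N k : nat) : (k <= N)%nat -> (-1) ^ (N - k) = (-1) ^ N * (-1) ^ k.
Proof.
intros H; transitivity ((-1) ^ (N - k) * (-1) ^ (2 * k)).
- rewrite Cpow_m1_double; ring.
- rewrite <- !Cpow_add_r; f_equal; lia.
Qed.

(** Reflection multiplies (-1)^k by (-1)^N and fixes the binomial, so the parity asked of [g] makes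
    the terms antisymmetric. This serves both vanishing sums of the theorem and also discards one
    half of the expansion of the sine powers. *)
Lemma alternating_binomial_sum_0 (g : nat -> C) (N : nat) :
  (forall k, (k <= N)%nat -> g (N - k)%nat = - (-1) ^ N * g k) ->
  Csum (fun k => (-1) ^ k * Cbinom N k * g k) N = 0.
Proof.
intros H; apply Csum_antisym; intros k Hk.
rewrite Cbinom_sym, H, Cpow_m1_sub by exact Hk.
transitivity (- ((-1) ^ N * (-1) ^ N) * ((-1) ^ k * Cbinom N k * g k)); [ring | ].
replace ((-1) ^ N * (-1) ^ N) with ((-1) ^ (2 * N)).
- rewrite Cpow_m1_double; ring.
- rewrite <- Cpow_add_r; f_equal; lia.
Qed.

(** Binomial expansion of (e^(ix) - e^(-ix))^N: the k-th term carries the frequency N - 2k, and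
    Euler's formula splits it. *)
Lemma Cpow_Csin (N : nat) (x : C) :
  (2 * Ci) ^ N * Csin x ^ N =
  Csum (fun k => (-1) ^ k * Cbinom N k * Ccos ((INR N - 2 * INR k) * x)) N +
  Ci * Csum (fun k => (-1) ^ k * Cbinom N k * Csin ((INR N - 2 * INR k) * x)) N.
Proof.
rewrite <- Cpow_mult_l.
replace (2 * Ci * Csin x) with (Cexp (Ci * x) + -1 * Cexp (- (Ci * x)))
  by (unfold Csin; field; exact Ci_nz).
rewrite Cbinomial, <- Csum_scal, <- Csum_plus; apply Csum_ext; intros k Hk.
rewrite Cpow_mult_l, <- !Cexp_INR_mult.
transitivity ((-1) ^ k * Cbinom N k
  * Cexp (Ci * ((INR N - 2 * INR k) * x))).
- transitivity ((-1) ^ k * Cbinom N k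
    * (Cexp (INR (N - k) * (Ci * x)) * Cexp (INR k * - (Ci * x)))); [ring | ].
  rewrite <- Cexp_plus, minus_INR, RtoC_minus by exact Hk; do 2 f_equal; ring.
- rewrite Cexp_Ccos_Csin; ring.
Qed.

Lemma Cpow_2Ci_double (n : nat) : (2 * Ci) ^ (2 * n) = (-1) ^ n * 4 ^ n.
Proof.
rewrite Cpow_mult_r, <- Cpow_mult_l; f_equal.
transitivity (4 * (Ci * Ci)); [ring | rewrite Ci2; ring].
Qed.

Lemma Cpow_Csin_even (n : nat) (x : C) :
  4 ^ n * Csin x ^ (2 * n) =
  (-1) ^ n * Csum (fun k => (-1) ^ k * Cbinom (2 * n) k
                     * Ccos (2 * (INR n - INR k) * x)) (2 * n).
Proof.
transitivity ((-1) ^ (2 * n) * (4 ^ n * Csin x ^ (2 * n)));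
  [rewrite Cpow_m1_double; ring | ].
replace (2 * n)%nat with (n + n)%nat at 1 by lia; rewrite Cpow_add_r.
transitivity ((-1) ^ n * ((2 * Ci) ^ (2 * n) * Csin x ^ (2 * n)));
  [rewrite Cpow_2Ci_double; ring | ].
rewrite Cpow_Csin; f_equal.
rewrite (alternating_binomial_sum_0 (fun k => Csin _)).
- rewrite Cmult_0_r, Cplus_0_r; apply Csum_ext; intros k _.
  rewrite mult_INR, RtoC_mult; do 2 f_equal.
  change (INR 2) with 2%R; try change (INR 1) with 1%R; ring.
- intros k Hk; rewrite Cpow_m1_double, minus_INR, RtoC_minus by exact Hk.
  transitivity (- Csin ((INR (2 * n) - 2 * INR k) * x)); [ | ring].
  rewrite <- Csin_opp; f_equal; ring.
Qed.

(** For an odd exponent the cosine half cancels. The surviving sine half has a factor i, matched by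
    (2i)^(2n+1) = 2i (-1)^n 4^n. *)
Lemma Cpow_Csin_odd (n : nat) (x : C) :
  2 * (-1) ^ n * 4 ^ n * Csin x ^ (2 * n + 1) =
  Csum (fun k => (-1) ^ k * Cbinom (1 + 2 * n) k
          * Csin ((2 * INR n - 2 * INR k + 1) * x)) (1 + 2 * n).
Proof.
generalize (Cpow_Csin (1 + 2 * n) x).
rewrite (alternating_binomial_sum_0 (fun k => Ccos _)).
- rewrite Cplus_0_l, !Cpow_add_r, Cpow_2Ci_double, !Cpow_1_r; intros E.
  transitivity (/ Ci * (2 * Ci * ((-1) ^ n * 4 ^ n) * (Csin x * Csin x ^ (2 * n))));
    [field; exact Ci_nz | ].
  rewrite E, Cmult_assoc, Cinv_l, Cmult_1_l by exact Ci_nz.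
  apply Csum_ext; intros k _.
  rewrite plus_INR, mult_INR, RtoC_plus, RtoC_mult; do 2 f_equal.
  change (INR 2) with 2%R; try change (INR 1) with 1%R; ring.
- intros k Hk; rewrite Cpow_add_r, Cpow_m1_double, Cpow_1_r.
  rewrite minus_INR, RtoC_minus by exact Hk.
  transitivity (Ccos ((INR (1 + 2 * n) - 2 * INR k) * x)); [ | ring].
  rewrite <- Ccos_opp; f_equal; ring.
Qed.

(** Parity, decided in Z; this is why the sums up to 1 + 2n exclude no index. *)
Lemma odd_neq_0 (n k : nat) : 2 * INR n - 2 * INR k + 1 <> 0.
Proof.
rewrite !INR_IZR_INZ, <- !RtoC_mult, <- RtoC_minus, <- RtoC_plus.
apply RtoC_neq; rewrite <- !mult_IZR, <- minus_IZR, <- plus_IZR.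
apply not_0_IZR; lia.
Qed.

Lemma INR_minus_neq_0 (n k : nat) : k <> n -> INR n - INR k <> 0.
Proof.
intros H; rewrite <- RtoC_minus; apply RtoC_neq; intros E.
apply H, INR_eq; lra.
Qed.

(* [4 ^ n] times a primitive of [sin ^ (2 n)]. *)
Definition sin_even_prim (n : nat) (x : C) : C :=
  Cbinom (2 * n) n * x +
  (-1) ^ n *
  Csum_except
    (fun k => (-1) ^ k * Cbinom (2 * n) k *
       (Csin (2 * (INR n - INR k) * x) / (2 * (INR n - INR k)))) (2 * n) n.

(* [-2 (-1) ^ n 4 ^ n] times a primitive of [sin ^ (2 n + 1)]. *)
Definition sin_odd_prim (n : nat) (x : C) : C :=
  Csum
    (fun k => (-1) ^ k * Cbinom (1 + 2 * n) k *
       ((Ccos ((2 * INR n - 2 * INR k + 1) * x) - 1) /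
        (2 * INR n - 2 * INR k + 1))) (1 + 2 * n).

Lemma sin_even_prim_0 (n : nat) : sin_even_prim n 0 = 0.
Proof.
unfold sin_even_prim, Csum_except.
rewrite (Csum_ext _ (fun _ => 0)), Csum_0; [ring | ].
intros k _; destruct (Nat.eqb k n); [reflexivity | ].
rewrite Cmult_0_r, Csin_0; unfold Cdiv; ring.
Qed.

(** The [- 1] in each numerator is the integration constant that gives this primitive the same
    initial value as [ray_prim]. *)
Lemma sin_odd_prim_0 (n : nat) : sin_odd_prim n 0 = 0.
Proof.
unfold sin_odd_prim; rewrite (Csum_ext _ (fun _ => 0)), Csum_0; [ring | ].
intros k _; rewrite Cmult_0_r, Ccos_0; unfold Cdiv; ring.
Qed.

Lemma Csum_if_eq (c : C) (N j : nat) :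
  (j <= N)%nat -> Csum (fun k => if Nat.eqb k j then c else 0) N = c.
Proof.
induction N as [|N IH]; intros H.
- rewrite Csum_O; now replace j with 0%nat by lia.
- rewrite Csum_S; destruct (Nat.eqb_spec (S N) j) as [<- | Hj].
  + rewrite (Csum_ext _ (fun _ => 0)), Csum_0; [ring | ].
    intros k Hk; now replace (Nat.eqb k (S N)) with false
      by (symmetry; apply Nat.eqb_neq; lia).
  + rewrite IH by lia; ring.
Qed.

Lemma is_Cderive_sin_even_prim (n : nat) (f : R -> C) (t : R) (df : C) :
  is_Cderive f t df ->
  is_Cderive (fun s => sin_even_prim n (f s)) t (4 ^ n * Csin (f t) ^ (2 * n) * df).
Proof.
intros F; unfold sin_even_prim, Csum_except.
eapply is_Cderive_eq.
- apply is_Cderive_plus; [apply is_Cderive_scal; exact F | ].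
  apply is_Cderive_scal, is_Cderive_Csum with
    (df := fun k => if Nat.eqb k n then RtoC 0 else
       (-1) ^ k * Cbinom (2 * n) k * Ccos (2 * (INR n - INR k) * f t) * df).
  intros k _; destruct (Nat.eqb_spec k n) as [_ | Hk]; [apply is_Cderive_const | ].
  eapply (is_Cderive_ext (fun s => (-1) ^ k * Cbinom (2 * n) k / (2 * (INR n - INR k))
    * Csin (2 * (INR n - INR k) * f s))).
  { intros s; unfold Cdiv; ring. }
  eapply is_Cderive_eq.
  + apply is_Cderive_scal, is_Cderive_sin, is_Cderive_scal, F.
  + simpl; field; apply INR_minus_neq_0, Hk.
- rewrite Cpow_Csin_even.
  (* The frequency 0 term k = n is separated: it is the constant whose primitive is the linear term
     of [sin_even_prim]. *)
  rewrite (Csum_ext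
    (fun k => (-1) ^ k * Cbinom (2 * n) k * Ccos (2 * (INR n - INR k) * f t))
    (fun k => (if Nat.eqb k n then (-1) ^ n * Cbinom (2 * n) n else 0) +
       (if Nat.eqb k n then RtoC 0 else
         (-1) ^ k * Cbinom (2 * n) k * Ccos (2 * (INR n - INR k) * f t)))).
  + rewrite Csum_plus, Csum_if_eq by lia.
    rewrite (Csum_ext (fun k => if Nat.eqb k n then RtoC 0 else _ * df)
      (fun k => df * (if Nat.eqb k n then RtoC 0 else
         (-1) ^ k * Cbinom (2 * n) k * Ccos (2 * (INR n - INR k) * f t)))).
    * rewrite Csum_scal.
      transitivity ((-1) ^ (2 * n) * Cbinom (2 * n) n * df + (-1) ^ n *
        (df * Csum (fun k => if Nat.eqb k n then RtoC 0 else
         (-1) ^ k * Cbinom (2 * n) k * Ccos (2 * (INR n - INR k) * f t)) (2 * n))).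
      { rewrite Cpow_m1_double; ring. }
      (* The sign of the constant term meets the outer (-1)^n, and their product is 1. *)
      replace (2 * n)%nat with (n + n)%nat at 1 by lia; rewrite Cpow_add_r; ring.
    * intros k _; destruct (Nat.eqb k n); ring.
  + intros k _; destruct (Nat.eqb_spec k n) as [-> | _]; [ | ring].
    replace (2 * (INR n - INR n) * f t) with (RtoC 0) by ring.
    rewrite Ccos_0; ring.
Qed.

Lemma is_Cderive_sin_odd_prim (n : nat) (f : R -> C) (t : R) (df : C) :
  is_Cderive f t df ->
  is_Cderive (fun s => sin_odd_prim n (f s)) t
    (- (2 * (-1) ^ n * 4 ^ n * Csin (f t) ^ (2 * n + 1) * df)).
Proof.
intros F; unfold sin_odd_prim; rewrite Cpow_Csin_odd.
eapply is_Cderive_eq.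
- apply is_Cderive_Csum with (df := fun k => (- df) *
    ((-1) ^ k * Cbinom (1 + 2 * n) k * Csin ((2 * INR n - 2 * INR k + 1) * f t))).
  intros k _.
  eapply (is_Cderive_ext (fun s =>
    (-1) ^ k * Cbinom (1 + 2 * n) k / (2 * INR n - 2 * INR k + 1)
    * (Ccos ((2 * INR n - 2 * INR k + 1) * f s) - 1))).
  { intros s; unfold Cdiv; ring. }
  eapply is_Cderive_eq.
  + apply is_Cderive_scal, is_Cderive_minus; [ | apply is_Cderive_const].
    apply is_Cderive_cos, is_Cderive_scal, F.
  + cbv beta; field; apply odd_neq_0.
- rewrite Csum_scal; ring.
Qed.

(** Reflection negates the frequency; sin(f x) / f is even in f, which is the parity required for an
    odd N. *)
Lemma sine_sum_0 (n : nat) (x : C) :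
  Csum
    (fun k => (-1) ^ k * Cbinom (1 + 2 * n) k *
       (Csin ((2 * INR n - 2 * INR k + 1) * x) /
        (2 * INR n - 2 * INR k + 1))) (1 + 2 * n) = 0.
Proof.
apply (alternating_binomial_sum_0
  (fun k => Csin ((2 * INR n - 2 * INR k + 1) * x) / (2 * INR n - 2 * INR k + 1))).
intros k Hk; rewrite Cpow_add_r, Cpow_m1_double, Cpow_1_r.
assert (E : 2 * INR n - 2 * INR (1 + 2 * n - k) + 1 = - (2 * INR n - 2 * INR k + 1)).
{ rewrite minus_INR, plus_INR, mult_INR by exact Hk.
  rewrite RtoC_minus, RtoC_plus, RtoC_mult.
  change (INR 2) with 2%R; try change (INR 1) with 1%R; ring. }
rewrite E.
replace (- (2 * INR n - 2 * INR k + 1) * x) with (- ((2 * INR n - 2 * INR k + 1) * x)) by ring.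
rewrite Csin_opp.
field; apply odd_neq_0.
Qed.

(** Here (1 - cos) / f is odd in the frequency, as an even N requires, and the excluded index n is
    the fixed point of k -> 2n - k, so the exclusion respects the reflection. *)
Lemma cosine_sum_0 (n : nat) (x : C) :
  Csum_except
    (fun k => (-1) ^ k * Cbinom (2 * n) k *
       ((1 - Ccos (2 * (INR n - INR k) * x)) / (INR n - INR k))) (2 * n) n = 0.
Proof.
unfold Csum_except.
rewrite (Csum_ext _ (fun k => (-1) ^ k * Cbinom (2 * n) k * (if Nat.eqb k n then RtoC 0 else
  (1 - Ccos (2 * (INR n - INR k) * x)) / (INR n - INR k)))).
2:{ intros k _; destruct (Nat.eqb k n); ring. }
apply alternating_binomial_sum_0; intros k Hk; rewrite Cpow_m1_double.
replace (Nat.eqb (2 * n - k) n) with (Nat.eqb k n).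
2:{ destruct (Nat.eqb_spec k n), (Nat.eqb_spec (2 * n - k) n); lia. }
destruct (Nat.eqb_spec k n) as [_ | Hkn]; [ring | ].
assert (E : INR n - INR (2 * n - k) = - (INR n - INR k)).
{ rewrite minus_INR, mult_INR by exact Hk.
  rewrite RtoC_minus, RtoC_mult.
  change (INR 2) with 2%R; try change (INR 1) with 1%R; ring. }
assert (H1 := INR_minus_neq_0 n k Hkn).
rewrite E; replace (2 * - (INR n - INR k) * x) with (- (2 * (INR n - INR k) * x)) by ring.
rewrite Ccos_opp; field; exact H1.
Qed.

(** * Limits and power series *)

Definition Ctends1 (f : R -> C) (l : C) : Prop :=
  filterlim (fun t => Re (f t)) (at_left 1) (locally (Re l)) /\
  filterlim (fun t => Im (f t)) (at_left 1) (locally (Im l)).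

Lemma filterlim_Rplus (f g : R -> R) (x y : R) :
  filterlim f (at_left 1) (locally x) -> filterlim g (at_left 1) (locally y) ->
  filterlim (fun t => f t + g t)%R (at_left 1) (locally (x + y)%R).
Proof.
intros F G; refine (filterlim_comp_2 f g Rplus F G _).
exact (filterlim_plus (V := R_NormedModule) x y).
Qed.

Lemma filterlim_Rmult (f g : R -> R) (x y : R) :
  filterlim f (at_left 1) (locally x) -> filterlim g (at_left 1) (locally y) ->
  filterlim (fun t => f t * g t)%R (at_left 1) (locally (x * y)%R).
Proof.
intros F G; refine (filterlim_comp_2 f g Rmult F G _).
exact (filterlim_mult (K := R_AbsRing) x y).
Qed.

Lemma filterlim_continuous (h f : R -> R) (x : R) :
  continuous h x -> filterlim f (at_left 1) (locally x) ->
  filterlim (fun t => h (f t)) (at_left 1) (locally (h x)).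
Proof. intros H F; exact (filterlim_comp _ _ _ f h _ _ _ F H). Qed.

Lemma Ctends1_const (c : C) : Ctends1 (fun _ => c) c.
Proof.
split; [exact (filterlim_const (U := R_UniformSpace) (Re c))
      | exact (filterlim_const (U := R_UniformSpace) (Im c))].
Qed.

Lemma Ctends1_RtoC (f : R -> R) (l : R) :
  filterlim f (at_left 1) (locally l) -> Ctends1 (fun t => RtoC (f t)) l.
Proof. intros H; split; [exact H | exact (filterlim_const (U := R_UniformSpace) 0%R)]. Qed.

Lemma Ctends1_id : Ctends1 (fun t => RtoC t) 1.
Proof. apply Ctends1_RtoC; intros P HP; now apply filter_le_within. Qed.

Lemma Ctends1_plus (f g : R -> C) (x y : C) :
  Ctends1 f x -> Ctends1 g y -> Ctends1 (fun t => f t + g t) (x + y).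
Proof.
intros [F1 F2] [G1 G2]; split;
  [exact (filterlim_Rplus _ _ _ _ F1 G1) | exact (filterlim_Rplus _ _ _ _ F2 G2)].
Qed.

Lemma Ctends1_mult (f g : R -> C) (x y : C) :
  Ctends1 f x -> Ctends1 g y -> Ctends1 (fun t => f t * g t) (x * y).
Proof.
intros [F1 F2] [G1 G2]; split.
- apply (filterlim_Rplus (fun t => Re (f t) * Re (g t))%R
    (fun t => - (Im (f t) * Im (g t)))%R); [exact (filterlim_Rmult _ _ _ _ F1 G1) | ].
  apply (filterlim_continuous Ropp).
  + apply (filterlim_opp (V := R_NormedModule)).
  + exact (filterlim_Rmult _ _ _ _ F2 G2).
- exact (filterlim_Rplus _ _ _ _ (filterlim_Rmult _ _ _ _ F1 G2)
    (filterlim_Rmult _ _ _ _ F2 G1)).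
Qed.

Lemma Ctends1_scal (c : C) (f : R -> C) (x : C) :
  Ctends1 f x -> Ctends1 (fun t => c * f t) (c * x).
Proof. intros F; exact (Ctends1_mult _ _ _ _ (Ctends1_const c) F). Qed.

Lemma Ctends1_ext (f g : R -> C) (x : C) :
  (forall t, f t = g t) -> Ctends1 f x -> Ctends1 g x.
Proof.
intros E [F1 F2]; split.
- refine (filterlim_ext _ _ _ F1); intros t; now rewrite E.
- refine (filterlim_ext _ _ _ F2); intros t; now rewrite E.
Qed.

Lemma Ctends1_opp (f : R -> C) (x : C) : Ctends1 f x -> Ctends1 (fun t => - f t) (- x).
Proof.
intros F; replace (- x) with (-1 * x) by ring.
apply (Ctends1_ext (fun t => -1 * f t)); [intros t; ring | now apply Ctends1_scal].
Qed.

Lemma Ctends1_minus (f g : R -> C) (x y : C) :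
  Ctends1 f x -> Ctends1 g y -> Ctends1 (fun t => f t - g t) (x - y).
Proof. intros F G; exact (Ctends1_plus _ _ _ _ F (Ctends1_opp _ _ G)). Qed.

Lemma Ctends1_pow (f : R -> C) (x : C) (m : nat) :
  Ctends1 f x -> Ctends1 (fun t => f t ^ m) (x ^ m).
Proof.
intros F; induction m as [|m IH]; [apply Ctends1_const | ].
exact (Ctends1_mult _ _ _ _ F IH).
Qed.

Lemma Ctends1_exp (f : R -> C) (x : C) :
  Ctends1 f x -> Ctends1 (fun t => Cexp (f t)) (Cexp x).
Proof.
intros [F1 F2]; apply Ctends1_mult.
- apply Ctends1_RtoC, filterlim_continuous; [apply continuous_exp | exact F1].
- apply Ctends1_plus.
  + apply Ctends1_RtoC, (filterlim_continuous cos); [apply continuous_cos | exact F2].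
  + apply Ctends1_scal, Ctends1_RtoC, (filterlim_continuous sin);
      [apply continuous_sin | exact F2].
Qed.

Lemma Ctends1_sin (f : R -> C) (x : C) :
  Ctends1 f x -> Ctends1 (fun t => Csin (f t)) (Csin x).
Proof.
intros F; apply Ctends1_mult; [ | apply Ctends1_const].
apply Ctends1_minus; apply Ctends1_exp; [ | apply Ctends1_opp]; now apply Ctends1_scal.
Qed.

Lemma Ctends1_cos (f : R -> C) (x : C) :
  Ctends1 f x -> Ctends1 (fun t => Ccos (f t)) (Ccos x).
Proof.
intros F; apply Ctends1_mult; [ | apply Ctends1_const].
apply Ctends1_plus; apply Ctends1_exp; [ | apply Ctends1_opp]; now apply Ctends1_scal.
Qed.

Lemma Ctends1_Csum (f : nat -> R -> C) (l : nat -> C) (N : nat) :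
  (forall k, Ctends1 (f k) (l k)) ->
  Ctends1 (fun t => Csum (fun k => f k t) N) (Csum l N).
Proof.
intros H; induction N as [|N IH].
- rewrite Csum_O; apply (Ctends1_ext (f 0%nat)); [ | apply H].
  intros t; now rewrite Csum_O.
- rewrite Csum_S; apply (Ctends1_ext (fun t => Csum (fun k => f k t) N + f (S N) t)).
  + intros t; now rewrite Csum_S.
  + apply Ctends1_plus; [exact IH | apply H].
Qed.

Lemma Ctends1_sin_even_prim (n : nat) (f : R -> C) (x : C) :
  Ctends1 f x -> Ctends1 (fun t => sin_even_prim n (f t)) (sin_even_prim n x).
Proof.
intros F; apply Ctends1_plus; apply Ctends1_scal; [exact F | ].
apply (Ctends1_Csum (fun k t => if Nat.eqb k n then RtoC 0 else _)); intros k.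
destruct (Nat.eqb k n); [apply Ctends1_const | ].
apply Ctends1_scal, Ctends1_mult; [ | apply Ctends1_const].
now apply Ctends1_sin, Ctends1_scal.
Qed.

Lemma Ctends1_sin_odd_prim (n : nat) (f : R -> C) (x : C) :
  Ctends1 f x -> Ctends1 (fun t => sin_odd_prim n (f t)) (sin_odd_prim n x).
Proof.
intros F; apply (Ctends1_Csum (fun k t => _)); intros k.
apply Ctends1_scal, Ctends1_mult; [ | apply Ctends1_const].
apply Ctends1_minus; [ | apply Ctends1_const].
now apply Ctends1_cos, Ctends1_scal.
Qed.

(** Carries an identity from the open part of the ray to its endpoint. *)
Lemma Ctends1_unique (f g : R -> C) (x y : C) :
  (forall t, (0 <= t < 1)%R -> f t = g t) -> Ctends1 f x -> Ctends1 g y -> x = y.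
Proof.
intros E [F1 F2] [G1 G2].
assert (L : at_left 1 (fun t => f t = g t)).
{ exists (mkposreal 1 Rlt_0_1); intros t Ht Ht1; apply E.
  apply Rabs_lt_between in Ht; unfold minus, plus, opp in Ht; simpl in Ht; lra. }
apply C_ext.
- refine (filterlim_locally_unique _ _ _ F1 _).
  refine (filterlim_ext_loc _ _ _ G1).
  apply (filter_imp _ _ (fun t Ht => f_equal Re (eq_sym Ht)) L).
- refine (filterlim_locally_unique _ _ _ F2 _).
  refine (filterlim_ext_loc _ _ _ G2).
  apply (filter_imp _ _ (fun t Ht => f_equal Im (eq_sym Ht)) L).
Qed.

(** * Complex series through their real and imaginary parts *)

(** Shaped like the body of [hyp2F1], so that a hypergeometric value is a [Cseries] by
    conversion. *)
Definition Cseries (u : nat -> C) : C :=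
  (Series (fun m => Re (u m)), Series (fun m => Im (u m))).

Definition Csummable (u : nat -> C) : Prop := ex_series (fun m => Cmod (u m)).

Lemma im_le_Cmod (c : C) : (Rabs (Im c) <= Cmod c)%R.
Proof. eapply Rle_trans; [apply Rmax_r | apply Rmax_Cmod]. Qed.

Lemma Csummable_le (u : nat -> C) (b : nat -> R) :
  (forall m, Cmod (u m) <= b m)%R -> ex_series b -> Csummable u.
Proof.
intros H Hb; refine (ex_series_le (V := R_CompleteNormedModule) _ b _ Hb).
intros m; unfold norm; simpl; unfold abs; simpl.
rewrite Rabs_pos_eq; [apply H | apply Cmod_ge_0].
Qed.

Lemma Csummable_Re_abs (u : nat -> C) :
  Csummable u -> ex_series (fun m => Rabs (Re (u m))).
Proof.
intros H; refine (ex_series_le (V := R_CompleteNormedModule) _ _ _ H).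
intros m; unfold norm; simpl; unfold abs; simpl.
rewrite Rabs_Rabsolu; apply re_le_Cmod.
Qed.

Lemma Csummable_Im_abs (u : nat -> C) :
  Csummable u -> ex_series (fun m => Rabs (Im (u m))).
Proof.
intros H; refine (ex_series_le (V := R_CompleteNormedModule) _ _ _ H).
intros m; unfold norm; simpl; unfold abs; simpl.
rewrite Rabs_Rabsolu; apply im_le_Cmod.
Qed.

Lemma Csummable_Re (u : nat -> C) : Csummable u -> ex_series (fun m => Re (u m)).
Proof. intros H; apply ex_series_Rabs, Csummable_Re_abs, H. Qed.

Lemma Csummable_Im (u : nat -> C) : Csummable u -> ex_series (fun m => Im (u m)).
Proof. intros H; apply ex_series_Rabs, Csummable_Im_abs, H. Qed.

Lemma Csummable_scal (c : C) (u : nat -> C) : Csummable u -> Csummable (fun m => c * u m).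
Proof.
intros H; apply (Csummable_le _ (fun m => Cmod c * Cmod (u m))%R).
- intros m; rewrite Cmod_mult; apply Rle_refl.
- apply (ex_series_scal_l (K := R_AbsRing) (V := R_NormedModule)); exact H.
Qed.

Lemma Csummable_incr (u : nat -> C) : Csummable u -> Csummable (fun m => u (S m)).
Proof. intros H; apply (ex_series_incr_1 (fun m => Cmod (u m))); exact H. Qed.

Lemma Cseries_ext (u v : nat -> C) : (forall m, u m = v m) -> Cseries u = Cseries v.
Proof. intros H; unfold Cseries; f_equal; apply Series_ext; intros m; now rewrite H. Qed.

Lemma Cseries_plus (u v : nat -> C) :
  Csummable u -> Csummable v -> Cseries (fun m => u m + v m) = Cseries u + Cseries v.
Proof.
intros Hu Hv; unfold Cseries; apply C_ext; simpl.
- apply (Series_plus (fun m => Re (u m)) (fun m => Re (v m))); now apply Csummable_Re.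
- apply (Series_plus (fun m => Im (u m)) (fun m => Im (v m))); now apply Csummable_Im.
Qed.

Lemma Cseries_scal (c : C) (u : nat -> C) :
  Csummable u -> Cseries (fun m => c * u m) = c * Cseries u.
Proof.
intros Hu; assert (H1 := Csummable_Re u Hu); assert (H2 := Csummable_Im u Hu).
unfold Cseries; apply C_ext; simpl; rewrite <- !Series_scal_l.
- rewrite <- Series_minus; [reflexivity | | ];
    apply (ex_series_scal_l (K := R_AbsRing) (V := R_NormedModule)); assumption.
- rewrite <- Series_plus; [reflexivity | | ];
    apply (ex_series_scal_l (K := R_AbsRing) (V := R_NormedModule)); assumption.
Qed.

Lemma Cseries_incr_1 (u : nat -> C) :
  Csummable u -> Cseries u = u 0%nat + Cseries (fun m => u (S m)).
Proof.
intros Hu; unfold Cseries; apply C_ext; simpl.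
- apply (Series_incr_1 (fun m => Re (u m))); now apply Csummable_Re.
- apply (Series_incr_1 (fun m => Im (u m))); now apply Csummable_Im.
Qed.

Lemma Rabs_Series_le (a b : nat -> R) :
  (forall m, Rabs (a m) <= b m)%R -> ex_series b -> (Rabs (Series a) <= Series b)%R.
Proof.
intros H Hb; eapply Rle_trans; [apply Series_Rabs | apply Series_le; [ | exact Hb]].
- refine (ex_series_le (V := R_CompleteNormedModule) _ b _ Hb).
  intros m; unfold norm; simpl; unfold abs; simpl; rewrite Rabs_Rabsolu; apply H.
- intros m; split; [apply Rabs_pos | apply H].
Qed.

Lemma Re_Cseries_le (u : nat -> C) (b : nat -> R) :
  (forall m, Cmod (u m) <= b m)%R -> ex_series b -> (Rabs (Re (Cseries u)) <= Series b)%R.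
Proof.
intros H Hb; apply (Rabs_Series_le (fun m => Re (u m))); [ | exact Hb].
intros m; eapply Rle_trans; [apply re_le_Cmod | apply H].
Qed.

Lemma Im_Cseries_le (u : nat -> C) (b : nat -> R) :
  (forall m, Cmod (u m) <= b m)%R -> ex_series b -> (Rabs (Im (Cseries u)) <= Series b)%R.
Proof.
intros H Hb; apply (Rabs_Series_le (fun m => Im (u m))); [ | exact Hb].
intros m; eapply Rle_trans; [apply im_le_Cmod | apply H].
Qed.

Lemma bounded_CV_radius_ge_1 (a : nat -> R) (M : R) :
  (forall m, Rabs (a m) <= M)%R -> Rbar_le 1 (CV_radius a).
Proof.
intros H; apply (proj1 (CV_radius_bounded a)); exists M; intros m.
rewrite pow1, Rmult_1_r; apply H.
Qed.

Definition Cpseries (c : nat -> C) (x : R) : C := Cseries (fun m => c m * x ^ m).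

(** Powers of a real [x] are real, so both components are real power series; termwise
    differentiation and Abel's theorem are then applied to each. *)
Lemma Cpseries_PSeries (c : nat -> C) (x : R) :
  Cpseries c x = (PSeries (fun m => Re (c m)) x, PSeries (fun m => Im (c m)) x).
Proof.
unfold Cpseries, Cseries, PSeries; f_equal; apply Series_ext; intros m;
  rewrite <- RtoC_pow; [apply re_scal_r | apply im_scal_r].
Qed.

Lemma is_Cderive_Cpseries (c : nat -> C) (M x : R) :
  (forall m, Cmod (c m) <= M)%R -> (0 <= x < 1)%R ->
  is_Cderive (Cpseries c) x (Cpseries (fun m => INR (S m) * c (S m)) x).
Proof.
intros H Hx.
apply (is_Cderive_ext (fun s =>
  (PSeries (fun m => Re (c m)) s, PSeries (fun m => Im (c m)) s))).
{ intros s; now rewrite Cpseries_PSeries. }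
assert (E : forall a : nat -> R, (forall m, Rabs (a m) <= M)%R ->
  is_derive (PSeries a) x (PSeries (PS_derive a) x)).
{ intros a Ha; apply is_derive_PSeries.
  eapply Rbar_lt_le_trans; [ | exact (bounded_CV_radius_ge_1 a M Ha)].
  simpl; rewrite Rabs_pos_eq; lra. }
split; rewrite Cpseries_PSeries; simpl.
- eapply is_derive_eq; [apply E | ].
  + intros m; eapply Rle_trans; [apply re_le_Cmod | apply H].
  + apply PSeries_ext; intros m; unfold PS_derive.
    symmetry; apply (re_scal_l (INR (S m))).
- eapply is_derive_eq; [apply E | ].
  + intros m; eapply Rle_trans; [apply im_le_Cmod | apply H].
  + apply PSeries_ext; intros m; unfold PS_derive.
    symmetry; apply (im_scal_l (INR (S m))).
Qed.

(** [Abel] concerns the limit at the radius of convergence itself, so it covers radius 1; for a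
    larger radius 1 is an interior point and continuity is enough. A smaller radius is impossible
    because the coefficients tend to 0 and are bounded. *)
Lemma PSeries_at_left_1 (a : nat -> R) :
  ex_series (fun m => Rabs (a m)) ->
  filterlim (PSeries a) (at_left 1) (locally (PSeries a 1)).
Proof.
intros H.
assert (H1 : Rbar_le 1 (CV_radius a)).
{ destruct (filterlim_bounded (V := R_NormedModule) a) as [M HM].
  { exists 0%R; exact (ex_series_lim_0 _ (ex_series_Rabs _ H)). }
  exact (bounded_CV_radius_ge_1 a M HM). }
destruct (Rbar_le_lt_or_eq_dec _ _ H1) as [Hlt | Heq].
- assert (HC : continuity_pt (PSeries a) 1).
  { apply PSeries_continuity; now rewrite Rabs_R1. }
  apply continuity_pt_filterlim in HC.
  intros P HP; apply filter_le_within, HC, HP.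
- generalize (Abel a); rewrite <- Heq; intros HA; apply HA.
  + simpl; lra.
  + exact I.
  + apply ex_pseries_1, ex_series_Rabs, H.
Qed.

Lemma Ctends1_Cpseries (c : nat -> C) :
  Csummable c -> Ctends1 (Cpseries c) (Cpseries c 1).
Proof.
intros H; rewrite Cpseries_PSeries.
apply (Ctends1_ext (fun s =>
  (PSeries (fun m => Re (c m)) s, PSeries (fun m => Im (c m)) s))).
{ intros s; now rewrite Cpseries_PSeries. }
split; simpl; apply PSeries_at_left_1.
- apply Csummable_Re_abs, H.
- apply Csummable_Im_abs, H.
Qed.

(** * The series with coefficients (1/2)_m / m! *)

(* The coefficients [(1/2)_m / m!] of the power series of [(1 - x) ^ (-1/2)]. *)
Fixpoint half_coef (m : nat) : R :=
  match m with
  | O => 1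
  | S m' => half_coef m' * ((INR m' + 1 / 2) / (INR m' + 1))
  end.

Lemma half_coef_pos (m : nat) : (0 < half_coef m)%R.
Proof.
induction m as [|m IH]; simpl half_coef; [lra | ].
assert (H := pos_INR m); apply Rmult_lt_0_compat; [exact IH | ].
apply Rdiv_lt_0_compat; lra.
Qed.

(** From a_(m+1) / a_m = (2m + 1) / (2m + 2). It yields monotonicity, the telescoping sum and, as a
    generating function, [inv_sqrt_prim_1]. *)
Lemma half_coef_diff (m : nat) :
  (half_coef m - half_coef (S m) = half_coef m / (2 * (INR m + 1)))%R.
Proof. simpl half_coef; assert (H := pos_INR m); field; lra. Qed.

Lemma half_coef_le_1 (m : nat) : (half_coef m <= 1)%R.
Proof.
induction m as [|m IH]; [simpl; lra | ].
assert (H := pos_INR m); assert (D := half_coef_diff m).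
assert (0 < half_coef m / (2 * (INR m + 1)))%R; [ | lra].
apply Rdiv_lt_0_compat; [apply half_coef_pos | lra].
Qed.

Lemma half_coef_sum (N : nat) :
  (sum_n (fun m => half_coef m / (INR m + 1)) N = 2 - 2 * half_coef (S N))%R.
Proof.
assert (E : forall m, (half_coef m / (INR m + 1) = 2 * (half_coef m - half_coef (S m)))%R).
{ intros m; rewrite half_coef_diff; assert (H := pos_INR m); field; lra. }
induction N as [|N IH].
- rewrite sum_O, E; change (2 * (1 - half_coef 1) = 2 - 2 * half_coef 1)%R; ring.
- rewrite sum_Sn, IH, E.
  change (2 - 2 * half_coef (S N) + 2 * (half_coef (S N) - half_coef (S (S N))) =
    2 - 2 * half_coef (S (S N)))%R; ring.
Qed.

Lemma half_coef_div_pos (b : R) (m : nat) : (0 < b)%R -> (0 < half_coef m / (INR m + b))%R.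
Proof.
intros Hb; assert (H := pos_INR m); apply Rdiv_lt_0_compat; [apply half_coef_pos | lra].
Qed.

(* The series telescopes by [half_coef_diff]. *)
Lemma half_coef_series :
  ex_series (fun m => half_coef m / (INR m + 1))%R /\
  (Series (fun m => half_coef m / (INR m + 1)) <= 2)%R.
Proof.
assert (B : forall N, (sum_n (fun m => half_coef m / (INR m + 1)) N <= 2)%R).
{ intros N; rewrite half_coef_sum; assert (H := half_coef_pos (S N)); lra. }
assert (I : forall N, (sum_n (fun m => half_coef m / (INR m + 1)) N <=
  sum_n (fun m => half_coef m / (INR m + 1)) (S N))%R).
{ intros N; rewrite sum_Sn; assert (H := half_coef_div_pos 1 (S N) Rlt_0_1).
  change plus with Rplus; lra. }
destruct (ex_finite_lim_seq_incr _ _ I B) as [l Hl].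
split; [exists l; exact Hl | ].
rewrite (is_series_unique _ _ Hl).
exact (is_lim_seq_le _ _ (Finite l) (Finite 2) B Hl (is_lim_seq_const 2)).
Qed.

(** The factor comes from (1 + 1/b)(m + b) = m + 1 + b + m/b >= m + 1, which treats b < 1 and b > 1
    alike. *)
Lemma half_coef_div_le (b : R) (m : nat) :
  (0 < b)%R -> (half_coef m / (INR m + b) <= (1 + / b) * (half_coef m / (INR m + 1)))%R.
Proof.
intros Hb; assert (H := pos_INR m); assert (Ha := half_coef_pos m).
replace ((1 + / b) * (half_coef m / (INR m + 1)))%R
  with (half_coef m / (INR m + b) * ((1 + / b) * (INR m + b) / (INR m + 1)))%R
  by (field; lra).
rewrite <- (Rmult_1_r (half_coef m / (INR m + b))) at 1.
apply Rmult_le_compat_l; [apply Rlt_le, half_coef_div_pos, Hb | ].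
apply (Rmult_le_reg_r (INR m + 1)); [lra | ].
replace ((1 + / b) * (INR m + b) / (INR m + 1) * (INR m + 1))%R
  with (INR m + 1 + b + / b * INR m)%R by (field; lra).
assert (0 <= / b * INR m)%R; [ | lra].
apply Rmult_le_pos; [apply Rlt_le, Rinv_0_lt_compat, Hb | exact H].
Qed.

Lemma ex_series_half_coef_div (b : R) :
  (0 < b)%R -> ex_series (fun m => half_coef m / (INR m + b))%R.
Proof.
intros Hb.
refine (ex_series_le (V := R_CompleteNormedModule) _
  (fun m => (1 + / b) * (half_coef m / (INR m + 1)))%R _ _).
- intros m; unfold norm; simpl; unfold abs; simpl.
  rewrite Rabs_pos_eq; [apply half_coef_div_le, Hb | apply Rlt_le, half_coef_div_pos, Hb].
- apply (ex_series_scal_l (K := R_AbsRing) (V := R_NormedModule)), half_coef_series.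
Qed.

Lemma Cmod_pow_le_1 (z : C) (m : nat) : (Cmod z <= 1)%R -> (Cmod (z ^ m) <= 1)%R.
Proof.
intros Hz; rewrite Cmod_pow, <- (pow1 m); apply pow_incr.
split; [apply Cmod_ge_0 | exact Hz].
Qed.

Lemma Cmod_scal_pow_le (a : R) (z : C) (m : nat) :
  (0 <= a)%R -> (Cmod z <= 1)%R -> (Cmod (a * z ^ m) <= a)%R.
Proof.
intros Ha Hz; rewrite Cmod_mult, Cmod_R, Rabs_pos_eq by exact Ha.
rewrite <- (Rmult_1_r a) at 2; apply Rmult_le_compat_l; [exact Ha | ].
now apply Cmod_pow_le_1.
Qed.

Lemma Csummable_bounded (c : nat -> C) (M x : R) :
  (forall m, Cmod (c m) <= M)%R -> (0 <= x < 1)%R -> Csummable (fun m => c m * x ^ m).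
Proof.
intros H Hx; apply (Csummable_le _ (fun m => M * x ^ m)%R).
- intros m; rewrite Cmod_mult, Cmod_pow, Cmod_R, Rabs_pos_eq by apply Hx.
  apply Rmult_le_compat_r; [apply pow_le, Hx | apply H].
- apply (ex_series_scal_l (K := R_AbsRing) (V := R_NormedModule)), ex_series_geom.
  rewrite Rabs_pos_eq; lra.
Qed.

(* [inv_sqrt_coef z] and [prim_coef b z] are the coefficients in the real variable [x] of
   [(1 - x z) ^ (-1/2)] and of [x ^ (- b)] times a primitive of
   [x ^ (b - 1) * (1 - x z) ^ (-1/2)]. *)
Definition inv_sqrt_coef (z : C) (m : nat) : C := half_coef m * z ^ m.
Definition prim_coef (b : R) (z : C) (m : nat) : C :=
  (half_coef m / (INR m + b))%R * z ^ m.

Lemma inv_sqrt_coef_le (z : C) (m : nat) :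
  (Cmod z <= 1)%R -> (Cmod (inv_sqrt_coef z m) <= 1)%R.
Proof.
intros Hz; eapply Rle_trans; [ | apply (half_coef_le_1 m)].
apply Cmod_scal_pow_le; [apply Rlt_le, half_coef_pos | exact Hz].
Qed.

Lemma prim_coef_le (b : R) (z : C) (m : nat) :
  (0 < b)%R -> (Cmod z <= 1)%R ->
  (Cmod (prim_coef b z m) <= half_coef m / (INR m + b))%R.
Proof.
intros Hb Hz; apply Cmod_scal_pow_le; [apply Rlt_le, half_coef_div_pos, Hb | exact Hz].
Qed.

Lemma prim_coef_bounded (b : R) (z : C) (m : nat) :
  (0 < b)%R -> (Cmod z <= 1)%R -> (Cmod (prim_coef b z m) <= / b)%R.
Proof.
intros Hb Hz; eapply Rle_trans; [apply prim_coef_le; assumption | ].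
assert (H := pos_INR m); assert (H0 := half_coef_pos m); assert (H1 := half_coef_le_1 m).
unfold Rdiv; rewrite <- (Rmult_1_l (/ b)); apply Rmult_le_compat; try lra.
- apply Rlt_le, Rinv_0_lt_compat; lra.
- apply Rinv_le_contravar; lra.
Qed.

Lemma inv_sqrt_prim_coef (b : R) (z : C) (m : nat) :
  (0 < b)%R -> inv_sqrt_coef z m = INR m * prim_coef b z m + b * prim_coef b z m.
Proof.
intros Hb; unfold inv_sqrt_coef, prim_coef.
replace (half_coef m) with ((INR m + b) * (half_coef m / (INR m + b)))%R at 1.
- rewrite RtoC_mult, RtoC_plus; ring.
- assert (H := pos_INR m); field; lra.
Qed.

(** With F the series, (x^b F)' = x^(b-1) (b F + x F'). Only the bracket is stated, so no real power
    of x is needed and x = 0 is allowed. *)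
Lemma prim_ode (b : R) (z : C) (x : R) :
  (0 < b)%R -> (Cmod z <= 1)%R -> (0 <= x < 1)%R ->
  exists d, is_Cderive (Cpseries (prim_coef b z)) x d /\
    b * Cpseries (prim_coef b z) x + x * d = Cpseries (inv_sqrt_coef z) x.
Proof.
intros Hb Hz Hx; eexists; split.
{ apply (is_Cderive_Cpseries _ (/ b)); [ | exact Hx].
  intros m; now apply prim_coef_bounded. }
unfold Cpseries.
assert (S0 : Csummable (fun m => inv_sqrt_coef z m * x ^ m)).
{ apply (Csummable_bounded _ 1); [ | exact Hx]; intros m; now apply inv_sqrt_coef_le. }
assert (S1 : Csummable (fun m => prim_coef b z m * x ^ m)).
{ apply (Csummable_bounded _ (/ b)); [ | exact Hx]; intros m; now apply prim_coef_bounded. }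
assert (S2 : Csummable (fun m => INR (S m) * prim_coef b z (S m) * x ^ m)).
{ apply (Csummable_bounded _ 1); [ | exact Hx]; intros m.
  rewrite Cmod_mult, Cmod_R, Rabs_pos_eq by apply pos_INR.
  apply (Rle_trans _ (INR (S m) * (half_coef (S m) / (INR (S m) + b)))%R).
  - apply Rmult_le_compat_l; [apply pos_INR | now apply prim_coef_le].
  - assert (H := pos_INR (S m)); assert (H1 := half_coef_le_1 (S m)).
    assert (H2 := half_coef_pos (S m)).
    apply (Rmult_le_reg_r (INR (S m) + b)); [lra | ].
    replace (INR (S m) * (half_coef (S m) / (INR (S m) + b)) * (INR (S m) + b))%R
      with (INR (S m) * half_coef (S m))%R by (field; lra).
    assert (INR (S m) * half_coef (S m) <= INR (S m) * 1)%R; [ | lra].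
    now apply Rmult_le_compat_l. }
(* The product [x * d] has no constant term: index 0 is compared separately, and the rest at index m
   + 1. *)
rewrite (Cseries_incr_1 (fun m => prim_coef b z m * x ^ m)) by exact S1.
rewrite (Cseries_incr_1 (fun m => inv_sqrt_coef z m * x ^ m)) by exact S0.
rewrite Cmult_plus_distr_l, <- Cplus_assoc; f_equal.
- rewrite (inv_sqrt_prim_coef b) by exact Hb; simpl; ring.
- rewrite <- !Cseries_scal, <- Cseries_plus;
    [ | exact (Csummable_scal _ _ (Csummable_incr _ S1)) | now apply Csummable_scal
      | exact S2 | exact (Csummable_incr _ S1)].
  apply Cseries_ext; intros m.
  rewrite (inv_sqrt_prim_coef b z (S m)) by exact Hb; rewrite Cpow_S; ring.
Qed.

(** Generating-function form of [half_coef_diff]. The right-hand side is 1 minus half the integral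
    of (1 - s)^(-1/2) from 0 to x z, that is sqrt(1 - x z). *)
Lemma inv_sqrt_prim_1 (z : C) (x : R) :
  (Cmod z <= 1)%R -> (0 <= x < 1)%R ->
  (1 - x * z) * Cpseries (inv_sqrt_coef z) x =
  1 - x * z * Cpseries (prim_coef 1 z) x / 2.
Proof.
intros Hz Hx; unfold Cpseries.
assert (S0 : Csummable (fun m => inv_sqrt_coef z m * x ^ m)).
{ apply (Csummable_bounded _ 1); [ | exact Hx]; intros m; now apply inv_sqrt_coef_le. }
assert (S1 : Csummable (fun m => prim_coef 1 z m * x ^ m)).
{ apply (Csummable_bounded _ (/ 1)); [ | exact Hx].
  intros m; apply prim_coef_bounded; [exact Rlt_0_1 | exact Hz]. }
assert (E : Cseries (fun m => inv_sqrt_coef z m * x ^ m) =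
  1 + (x * z * Cseries (fun m => inv_sqrt_coef z m * x ^ m)
    + - (x * z / 2) * Cseries (fun m => prim_coef 1 z m * x ^ m))).
{ rewrite (Cseries_incr_1 _ S0) at 1; f_equal.
  - unfold inv_sqrt_coef; simpl; ring.
  - rewrite <- (Cseries_scal (x * z) _ S0), <- (Cseries_scal (- (x * z / 2)) _ S1).
    rewrite <- Cseries_plus by now apply Csummable_scal.
    apply Cseries_ext; intros m; unfold inv_sqrt_coef, prim_coef; rewrite !Cpow_S.
    replace (half_coef (S m))
      with (half_coef m - / 2 * (half_coef m / (INR m + 1)))%R.
    + rewrite RtoC_minus, RtoC_mult, RtoC_inv by lra; field.
    + assert (D := half_coef_diff m); assert (H := pos_INR m).
      replace (/ 2 * (half_coef m / (INR m + 1)))%R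
        with (half_coef m / (2 * (INR m + 1)))%R by (field; lra); lra. }
set (P := Cseries (fun m => inv_sqrt_coef z m * x ^ m)) in *.
transitivity (P - x * z * P); [ring | rewrite E at 1; field].
Qed.

(** * The arcsine along a ray *)

(** The inverse is the conjugate over the squared modulus, hence a real quotient in each
    component. *)
Lemma is_Cderive_inv (f : R -> C) (t : R) (df : C) :
  f t <> 0 -> is_Cderive f t df -> is_Cderive (fun s => / f s) t (- df / (f t * f t)).
Proof.
intros Hf [F1 F2].
assert (N : ((fst (f t)) ^ 2 + (snd (f t)) ^ 2 <> 0)%R).
{ intros E; apply Hf; apply C_ext; simpl; unfold Re, Im; nra. }
assert (D := is_derive_plus (V := R_NormedModule) _ _ _ _ _
  (is_derive_pow _ 2 _ _ F1) (is_derive_pow _ 2 _ _ F2)).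
split; eapply is_derive_eq.
- exact (is_derive_div _ _ _ _ _ F1 D N).
- unfold plus; simpl; unfold Re, Im; simpl.
  destruct (f t) as [a b]; simpl in *; field; split; nra.
- exact (is_derive_div _ _ _ _ _ (is_derive_opp (V := R_NormedModule) _ _ _ F2) D N).
- unfold plus, opp; simpl; unfold Re, Im; simpl.
  destruct (f t) as [a b]; simpl in *; field; split; nra.
Qed.

(* The integral of [u ^ p / sqrt (1 - u ^ 2)] along the segment from 0 to [t w]. *)
Definition ray_prim (p : nat) (w : C) (t : R) : C :=
  w ^ S p * t ^ S p * Cpseries (prim_coef (INR (S p) / 2) (w ^ 2)) (t ^ 2) / 2.

Definition ray_inv_sqrt (w : C) (t : R) : C := Cpseries (inv_sqrt_coef (w ^ 2)) (t ^ 2).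

Lemma INR_S_half_pos (p : nat) : (0 < INR (S p) / 2)%R.
Proof. assert (H := pos_INR p); rewrite S_INR; lra. Qed.

Lemma Cmod_sqr_le_1 (w : C) : (Cmod w <= 1)%R -> (Cmod (w ^ 2) <= 1)%R.
Proof. apply (Cmod_pow_le_1 w 2). Qed.

(** With b = (p + 1) / 2 and x = t^2, the derivative of t^(p+1) F(x) is 2 t^p (b F + x F'), and
    [prim_ode] evaluates the bracket. The 2 cancels the division by 2 in [ray_prim]. *)
Lemma is_Cderive_ray_prim (p : nat) (w : C) (t : R) :
  (Cmod w <= 1)%R -> (0 <= t < 1)%R ->
  is_Cderive (ray_prim p w) t (w * (t * w) ^ p * ray_inv_sqrt w t).
Proof.
intros Hw Ht.
destruct (prim_ode (INR (S p) / 2) (w ^ 2) (t ^ 2)) as [d [Hd E]].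
{ apply INR_S_half_pos. }
{ now apply Cmod_sqr_le_1. }
{ nra. }
unfold ray_prim.
apply (is_Cderive_ext (fun s => w ^ S p / 2 *
  (RtoC (s ^ S p)%R * Cpseries (prim_coef (INR (S p) / 2) (w ^ 2)) (s ^ 2)))).
{ intros s; rewrite RtoC_pow; unfold Cdiv; ring. }
eapply is_Cderive_eq.
- apply is_Cderive_scal, is_Cderive_mult.
  + apply is_Cderive_RtoC, is_derive_pow; apply (is_derive_id (K := R_AbsRing)).
  + apply (is_Cderive_comp (Cpseries (prim_coef (INR (S p) / 2) (w ^ 2)))
      (fun s => (s ^ 2)%R) t d (2 * t)%R Hd).
    eapply is_derive_eq; [apply is_derive_pow; apply (is_derive_id (K := R_AbsRing)) | ].
    unfold one; simpl; ring.
- unfold ray_inv_sqrt; rewrite <- E, Cpow_mult_l.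
  unfold one; simpl Init.Nat.pred; change (Ring.one _ _) with 1%R.
  rewrite !RtoC_mult, RtoC_div, !RtoC_pow by lra; rewrite !Cpow_S; simpl; field.
Qed.

Lemma Ctends1_ray_prim (p : nat) (w : C) :
  (Cmod w <= 1)%R -> Ctends1 (ray_prim p w) (ray_prim p w 1).
Proof.
intros Hw; unfold ray_prim, Cdiv.
apply Ctends1_mult; [ | apply Ctends1_const].
apply Ctends1_mult.
- apply Ctends1_scal, Ctends1_pow, Ctends1_id.
- replace (1 ^ 2)%R with 1%R by ring.
  assert (L : filterlim (fun t : R => (t ^ 2)%R) (at_left 1) (at_left 1)).
  { intros P [eps HP].
    (* For 0 < t < 1, 1 - t^2 < 2 (1 - t), hence eps / 2; the bound 1 keeps t positive. *)
    assert (He : (0 < Rmin 1 (eps / 2))%R).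
    { apply Rmin_pos; [lra | destruct eps; simpl; lra]. }
    exists (mkposreal _ He); intros t Ht Ht1.
    apply Rabs_lt_between in Ht; unfold minus, plus, opp in Ht; simpl in Ht.
    assert (H1 := Rmin_l 1 (eps / 2)); assert (H2 := Rmin_r 1 (eps / 2)).
    apply HP; [ | nra].
    apply Rabs_lt_between; unfold minus, plus, opp; simpl; split; nra. }
  destruct (Ctends1_Cpseries (prim_coef (INR (S p) / 2) (w ^ 2))) as [H1 H2].
  + apply (Csummable_le _ (fun m => half_coef m / (INR m + INR (S p) / 2))%R).
    * intros m; apply prim_coef_le; [apply INR_S_half_pos | now apply Cmod_sqr_le_1].
    * apply ex_series_half_coef_div, INR_S_half_pos.
  + split; [exact (filterlim_comp _ _ _ _ _ _ _ _ L H1)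
          | exact (filterlim_comp _ _ _ _ _ _ _ _ L H2)].
Qed.

Lemma ray_prim_0 (p : nat) (w : C) : ray_prim p w 0 = 0.
Proof. unfold ray_prim; rewrite (Cpow_S 0 p); unfold Cdiv; ring. Qed.

Definition ray_arcsin (w : C) (t : R) : C := ray_prim 0 w t.
(** This is sqrt(1 - t^2 w^2), since -sqrt(1 - u^2) is a primitive of u / sqrt(1 - u^2). As a power
    series it involves no choice of branch. *)
Definition ray_sqrt (w : C) (t : R) : C := 1 - ray_prim 1 w t.

Lemma is_Cderive_ray_arcsin (w : C) (t : R) :
  (Cmod w <= 1)%R -> (0 <= t < 1)%R ->
  is_Cderive (ray_arcsin w) t (w * ray_inv_sqrt w t).
Proof.
intros Hw Ht; eapply is_Cderive_eq; [now apply is_Cderive_ray_prim | simpl; ring].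
Qed.

Lemma is_Cderive_ray_sqrt (w : C) (t : R) :
  (Cmod w <= 1)%R -> (0 <= t < 1)%R ->
  is_Cderive (ray_sqrt w) t (- (w ^ 2 * t * ray_inv_sqrt w t)).
Proof.
intros Hw Ht; eapply is_Cderive_eq.
- apply is_Cderive_minus; [apply is_Cderive_const | now apply is_Cderive_ray_prim].
- simpl; ring.
Qed.

Lemma ray_sqrt_inv_sqrt (w : C) (t : R) :
  (Cmod w <= 1)%R -> (0 <= t < 1)%R ->
  (1 - t ^ 2 * w ^ 2) * ray_inv_sqrt w t = ray_sqrt w t.
Proof.
intros Hw Ht; unfold ray_inv_sqrt, ray_sqrt, ray_prim.
rewrite <- RtoC_pow, inv_sqrt_prim_1; [ | now apply Cmod_sqr_le_1 | nra].
replace (INR 2 / 2)%R with 1%R by (simpl; field).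
rewrite RtoC_pow; unfold Cdiv; ring.
Qed.

Lemma one_minus_sqr_neq_0 (w : C) (t : R) :
  (Cmod w <= 1)%R -> (0 <= t < 1)%R -> 1 - t ^ 2 * w ^ 2 <> 0.
Proof.
intros Hw Ht E.
assert (E1 : Cmod (t ^ 2 * w ^ 2) = 1%R).
{ rewrite <- Cmod_1; f_equal.
  transitivity (1 - (1 - t ^ 2 * w ^ 2)); [ring | rewrite E; ring]. }
rewrite <- RtoC_pow, Cmod_mult, Cmod_R, Rabs_pos_eq in E1 by nra.
assert (H := Cmod_sqr_le_1 w Hw); assert (H0 := Cmod_ge_0 (w ^ 2)); nra.
Qed.

(* [(sqrt (1 - t^2 w^2)) ^ 2 / (1 - t^2 w^2)] has derivative zero by [ray_sqrt_inv_sqrt]. *)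
Lemma ray_sqrt_sqr_lt (w : C) (t : R) :
  (Cmod w <= 1)%R -> (0 <= t < 1)%R -> ray_sqrt w t ^ 2 = 1 - t ^ 2 * w ^ 2.
Proof.
intros Hw Ht.
assert (E : ray_sqrt w t * ray_sqrt w t * / (1 - t ^ 2 * w ^ 2) =
  ray_sqrt w 0 * ray_sqrt w 0 * / (1 - 0%R ^ 2 * w ^ 2)).
{ apply (Cderive_0_const (fun s => ray_sqrt w s * ray_sqrt w s * / (1 - s ^ 2 * w ^ 2)));
    [lra | ].
  intros s Hs; assert (Hs1 : (0 <= s < 1)%R) by lra.
  assert (N := one_minus_sqr_neq_0 w s Hw Hs1).
  eapply is_Cderive_eq.
  - apply is_Cderive_mult.
    + apply is_Cderive_mult; apply is_Cderive_ray_sqrt; assumption.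
    + apply is_Cderive_inv; [exact N | ].
      apply is_Cderive_minus; [apply is_Cderive_const | ].
      apply is_Cderive_mult; [ | apply is_Cderive_const].
      apply (is_Cderive_ext (fun s => RtoC (s ^ 2)%R)).
      { intros r; now rewrite RtoC_pow. }
      apply is_Cderive_RtoC; eapply is_derive_eq.
      * apply is_derive_pow; apply (is_derive_id (K := R_AbsRing)).
      * instantiate (1 := (2 * s)%R); unfold one; simpl; ring.
  (* With q = 1 - s^2 w^2 and A = [ray_inv_sqrt w s], writing the root as q A turns the two terms
     into -2 w^2 s A^2 and 2 w^2 s A^2. *)
  - cbv beta; rewrite <- (ray_sqrt_inv_sqrt w s Hw Hs1), RtoC_mult; field.
    intros E0; apply N; rewrite <- E0; ring. }
assert (N := one_minus_sqr_neq_0 w t Hw Ht).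
unfold ray_sqrt at 3 4 in E; rewrite ray_prim_0 in E.
transitivity (ray_sqrt w t * ray_sqrt w t * / (1 - t ^ 2 * w ^ 2) * (1 - t ^ 2 * w ^ 2)).
- field; intros E0; apply N; rewrite <- E0; ring.
- rewrite E; field; exact C1_nz.
Qed.

Lemma ray_sqrt_sqr (w : C) : (Cmod w <= 1)%R -> ray_sqrt w 1 ^ 2 = 1 - w ^ 2.
Proof.
intros Hw; replace (1 - w ^ 2) with (1 - 1 ^ 2 * w ^ 2) by ring.
apply (Ctends1_unique (fun t => ray_sqrt w t ^ 2) (fun t => 1 - t ^ 2 * w ^ 2)).
- intros t Ht; now apply ray_sqrt_sqr_lt.
- apply Ctends1_pow, Ctends1_minus; [apply Ctends1_const | now apply Ctends1_ray_prim].
- apply Ctends1_minus; [apply Ctends1_const | ].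
  apply Ctends1_mult; [apply Ctends1_pow, Ctends1_id | apply Ctends1_const].
Qed.

(* [exp (- i arcsin) (sqrt (1 - t^2 w^2) + i t w)] has derivative zero. *)
Lemma Cexp_ray_arcsin_lt (w : C) (t : R) :
  (Cmod w <= 1)%R -> (0 <= t < 1)%R ->
  Cexp (Ci * ray_arcsin w t) = ray_sqrt w t + Ci * (t * w).
Proof.
intros Hw Ht.
assert (E : Cexp (- (Ci * ray_arcsin w t)) * (ray_sqrt w t + Ci * (t * w)) =
  Cexp (- (Ci * ray_arcsin w 0)) * (ray_sqrt w 0 + Ci * (0%R * w))).
{ apply (Cderive_0_const (fun s =>
    Cexp (- (Ci * ray_arcsin w s)) * (ray_sqrt w s + Ci * (s * w)))); [lra | ].
  intros s Hs; assert (Hs1 : (0 <= s < 1)%R) by lra.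
  assert (N := one_minus_sqr_neq_0 w s Hw Hs1).
  (* With R the root and q = 1 - s^2 w^2: R A = R (q A) / q = R^2 / q = 1. *)
  assert (P1 : ray_sqrt w s * ray_inv_sqrt w s = 1).
  { transitivity (ray_sqrt w s * ((1 - s ^ 2 * w ^ 2) * ray_inv_sqrt w s)
      / (1 - s ^ 2 * w ^ 2)); [field; intros E0; apply N; rewrite <- E0; ring | ].
    rewrite ray_sqrt_inv_sqrt, <- (ray_sqrt_sqr_lt w s) by assumption.
    field; intros E0; apply N; rewrite <- (ray_sqrt_sqr_lt w s Hw Hs1), E0; ring. }
  eapply is_Cderive_eq.
  - apply is_Cderive_mult.
    + apply is_Cderive_exp, is_Cderive_opp, is_Cderive_scal, is_Cderive_ray_arcsin;
        assumption.
    + apply is_Cderive_plus; [apply is_Cderive_ray_sqrt; assumption | ].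
      apply is_Cderive_scal, is_Cderive_mult; [ | apply is_Cderive_const].
      apply is_Cderive_RtoC; apply (is_derive_id (K := R_AbsRing)).
  - cbv beta; change (RtoC one) with (RtoC 1).
    transitivity (Cexp (- (Ci * ray_arcsin w s)) * w *
      (Ci * (1 - ray_sqrt w s * ray_inv_sqrt w s)
       - (Ci * Ci + 1) * (s * w * ray_inv_sqrt w s))); [ring | ].
    rewrite P1, Ci2; ring. }
unfold ray_arcsin at 2, ray_sqrt at 2 in E; rewrite !ray_prim_0 in E.
transitivity (Cexp (Ci * ray_arcsin w t) *
  (Cexp (- (Ci * ray_arcsin w t)) * (ray_sqrt w t + Ci * (t * w)))).
- rewrite E; replace (- (Ci * 0)) with (RtoC 0) by ring; rewrite Cexp_0; ring.
- rewrite Cmult_assoc, (Cmult_comm (Cexp _)), Cexp_opp_l; ring.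
Qed.

Lemma Cexp_ray_arcsin (w : C) :
  (Cmod w <= 1)%R -> Cexp (Ci * ray_arcsin w 1) = ray_sqrt w 1 + Ci * w.
Proof.
intros Hw; replace (Ci * w) with (Ci * (1 * w)) by ring.
apply (Ctends1_unique (fun t => Cexp (Ci * ray_arcsin w t))
  (fun t => ray_sqrt w t + Ci * (t * w))).
- intros t Ht; now apply Cexp_ray_arcsin_lt.
- now apply Ctends1_exp, Ctends1_scal, Ctends1_ray_prim.
- apply Ctends1_plus.
  + apply Ctends1_minus; [apply Ctends1_const | now apply Ctends1_ray_prim].
  + apply Ctends1_scal, Ctends1_mult; [apply Ctends1_id | apply Ctends1_const].
Qed.

(** The inverse of e^(i arcsin) = R + i t w is R - i t w, because their product is R^2 + t^2 w^2 =
    1. *)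
Lemma Csin_ray_arcsin (w : C) (t : R) :
  (Cmod w <= 1)%R -> (0 <= t < 1)%R -> Csin (ray_arcsin w t) = t * w.
Proof.
intros Hw Ht; unfold Csin.
replace (Cexp (- (Ci * ray_arcsin w t))) with (ray_sqrt w t - Ci * (t * w)).
- rewrite Cexp_ray_arcsin_lt by assumption; field; exact Ci_nz.
- transitivity (Cexp (- (Ci * ray_arcsin w t)) * Cexp (Ci * ray_arcsin w t) *
    (ray_sqrt w t - Ci * (t * w))); [rewrite Cexp_opp_l; ring | ].
  rewrite (Cexp_ray_arcsin_lt w t) by assumption.
  transitivity (Cexp (- (Ci * ray_arcsin w t)) *
    (ray_sqrt w t ^ 2 - Ci * Ci * (t ^ 2 * w ^ 2))); [ring | ].
  rewrite ray_sqrt_sqr_lt, Ci2 by assumption; ring.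
Qed.

(** The substitution u = sin theta in differential form: by [Csin_ray_arcsin] both sides, taken at t
    < 1, have the derivative 4^n (t w)^(2n) w [ray_inv_sqrt], and both vanish at t = 0. *)
Lemma sin_even_prim_ray_arcsin (n : nat) (w : C) :
  (Cmod w <= 1)%R ->
  sin_even_prim n (ray_arcsin w 1) = 4 ^ n * ray_prim (2 * n) w 1.
Proof.
intros Hw.
apply (Ctends1_unique (fun t => sin_even_prim n (ray_arcsin w t))
  (fun t => 4 ^ n * ray_prim (2 * n) w t)).
- intros t Ht; apply Ceq_minus.
  rewrite (Cderive_0_const (fun t => sin_even_prim n (ray_arcsin w t)
    - 4 ^ n * ray_prim (2 * n) w t) t); [ | apply Ht | ].
  + unfold ray_arcsin; rewrite !ray_prim_0, sin_even_prim_0; ring.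
  + intros s Hs; assert (Hs1 : (0 <= s < 1)%R) by lra.
    eapply is_Cderive_eq.
    * apply is_Cderive_minus.
      -- apply is_Cderive_sin_even_prim, is_Cderive_ray_arcsin; assumption.
      -- apply is_Cderive_scal, is_Cderive_ray_prim; assumption.
    * rewrite Csin_ray_arcsin by assumption; ring.
- now apply Ctends1_sin_even_prim, Ctends1_ray_prim.
- now apply Ctends1_scal, Ctends1_ray_prim.
Qed.

Lemma sin_odd_prim_ray_arcsin (n : nat) (w : C) :
  (Cmod w <= 1)%R ->
  sin_odd_prim n (ray_arcsin w 1) =
  - (2 * (-1) ^ n * 4 ^ n) * ray_prim (2 * n + 1) w 1.
Proof.
intros Hw.
apply (Ctends1_unique (fun t => sin_odd_prim n (ray_arcsin w t))
  (fun t => - (2 * (-1) ^ n * 4 ^ n) * ray_prim (2 * n + 1) w t)).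
- intros t Ht; apply Ceq_minus.
  rewrite (Cderive_0_const (fun t => sin_odd_prim n (ray_arcsin w t)
    - - (2 * (-1) ^ n * 4 ^ n) * ray_prim (2 * n + 1) w t) t); [ | apply Ht | ].
  + unfold ray_arcsin; rewrite !ray_prim_0, sin_odd_prim_0; ring.
  + intros s Hs; assert (Hs1 : (0 <= s < 1)%R) by lra.
    eapply is_Cderive_eq.
    * apply is_Cderive_minus.
      -- apply is_Cderive_sin_odd_prim, is_Cderive_ray_arcsin; assumption.
      -- apply is_Cderive_scal, is_Cderive_ray_prim; assumption.
    * rewrite Csin_ray_arcsin by assumption; ring.
- now apply Ctends1_sin_odd_prim, Ctends1_ray_prim.
- now apply Ctends1_scal, Ctends1_ray_prim.
Qed.

(** * Principal branches *)

Lemma Re_div_Cmod_bounds (z : C) : z <> 0 -> (-1 <= Re z / Cmod z <= 1)%R.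
Proof.
intros Hz; apply Cmod_gt_0 in Hz; apply Rabs_le_between.
unfold Rdiv; rewrite Rabs_mult, Rabs_inv, (Rabs_pos_eq (Cmod z)) by lra.
apply (Rmult_le_reg_r (Cmod z)); [exact Hz | ].
rewrite Rmult_assoc, Rinv_l, Rmult_1_r, Rmult_1_l by lra; apply re_le_Cmod.
Qed.

Lemma Carg_bounds (z : C) : (- PI <= Carg z <= PI)%R.
Proof.
unfold Carg; assert (H := acos_bound (Re z / Cmod z)).
destruct (Rle_dec 0 (Im z)); lra.
Qed.

Lemma polar_form (z : C) :
  z <> 0 -> z = Cmod z * (cos (Carg z) + Ci * sin (Carg z)).
Proof.
intros Hz; assert (B := Re_div_Cmod_bounds z Hz).
assert (H := Hz); apply Cmod_gt_0 in H.
(* This is the sine of the [acos] in [Carg]; the case split on the sign of [Im z] removes the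
   absolute value. *)
assert (S : sqrt (1 - (Re z / Cmod z)²) = (Rabs (Im z) / Cmod z)%R).
{ replace (1 - (Re z / Cmod z)²)%R with ((Rabs (Im z) / Cmod z)²)%R.
  - apply sqrt_Rsqr, Rmult_le_pos; [apply Rabs_pos | apply Rlt_le, Rinv_0_lt_compat, H].
  - rewrite !Rsqr_div', <- Rsqr_abs.
    assert (E := Cmod2_alt z); unfold Rsqr.
    replace (Im z * Im z)%R with (Cmod z * Cmod z - Re z * Re z)%R by lra.
    field; lra. }
assert (E : cos (Carg z) = (Re z / Cmod z)%R /\ sin (Carg z) = (Im z / Cmod z)%R).
{ unfold Carg; destruct (Rle_dec 0 (Im z)) as [Hi | Hi].
  - rewrite cos_acos, sin_acos, S, Rabs_pos_eq by assumption; split; reflexivity.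
  - rewrite cos_neg, sin_neg, cos_acos, sin_acos, S, Rabs_left by (try assumption; lra).
    split; [reflexivity | field; lra]. }
destruct E as [-> ->]; apply C_ext; simpl; unfold Re, Im; field; lra.
Qed.

Lemma Csqrt_sqr (z : C) : Csqrt z ^ 2 = z.
Proof.
unfold Csqrt; destruct (Ceq_dec z 0) as [-> | Hz].
- rewrite Cmod_0, sqrt_0; ring.
- rewrite Cpow_mult_l, <- RtoC_pow, pow2_sqrt by apply Cmod_ge_0.
  rewrite (polar_form z Hz) at 3; f_equal; simpl; rewrite Cmult_1_r, <- Cexp_plus.
  replace (Ci * (Carg z / 2)%R + Ci * (Carg z / 2)%R) with (Ci * Carg z).
  + unfold Cexp; simpl; replace (0 * Carg z - 1 * 0)%R with 0%R by ring.
    rewrite exp_0; replace (0 * 0 + 1 * Carg z)%R with (Carg z) by ring; ring.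
  + apply C_ext; simpl; field.
Qed.

(** The halved argument lies in [-PI/2, PI/2], where the cosine is nonnegative. *)
Lemma Re_Csqrt_nonneg (z : C) : (0 <= Re (Csqrt z))%R.
Proof.
assert (B := Carg_bounds z).
unfold Csqrt; rewrite re_scal_l; apply Rmult_le_pos; [apply sqrt_pos | ].
unfold Cexp; rewrite re_scal_l; apply Rmult_le_pos; [apply Rlt_le, exp_pos | ].
replace (Im (Ci * (Carg z / 2)%R)) with (Carg z / 2)%R by (simpl; ring).
replace (Re _) with (cos (Carg z / 2)) by (simpl; ring).
apply cos_ge_0; lra.
Qed.

Lemma Cmod_Csqrt (z : C) : (Cmod z <= 1)%R -> (Cmod (Csqrt z) <= 1)%R.
Proof.
intros Hz; assert (H := Cmod_ge_0 (Csqrt z)).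
assert (E := Cmod_pow (Csqrt z) 2); rewrite Csqrt_sqr in E; nra.
Qed.

(** Two opposite roots with nonnegative real parts both lie on the imaginary axis. There s^2 = -(Im
    s)^2, so the second hypothesis leaves only s = 0. *)
Lemma Csqrt_unique (s : C) :
  (0 <= Re s)%R -> (0 <= Re (s ^ 2))%R -> Csqrt (s ^ 2) = s.
Proof.
intros Hs Hv; assert (H := Re_Csqrt_nonneg (s ^ 2)); assert (E := Csqrt_sqr (s ^ 2)).
set (r := Csqrt (s ^ 2)) in *.
assert (F : (r - s) * (r + s) = 0).
{ transitivity (r ^ 2 - s ^ 2); [ring | rewrite E; ring]. }
destruct (Ceq_dec (r - s) 0) as [Z | Z]; [now apply Ceq_minus | ].
assert (F2 : r + s = 0).
{ transitivity (/ (r - s) * ((r - s) * (r + s))); [field; exact Z | rewrite F; ring]. }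
assert (R0 := f_equal Re F2); assert (I0 := f_equal Im F2).
destruct r as [a b], s as [c d]; simpl in *.
assert (c = 0)%R by lra; assert (a = 0)%R by lra; subst a c.
assert (d = 0)%R by nra; subst d; assert (b = 0)%R by lra; subst b; reflexivity.
Qed.

Lemma Cexp_Clog (z : C) : z <> 0 -> Cexp (Clog z) = z.
Proof.
intros Hz; rewrite (polar_form z Hz) at 2; unfold Cexp, Clog; simpl.
replace (ln (Cmod z) + (0 * Carg z - 1 * 0))%R with (ln (Cmod z)) by ring.
replace (0 + (0 * 0 + 1 * Carg z))%R with (Carg z) by ring.
rewrite exp_ln by now apply Cmod_gt_0.
reflexivity.
Qed.

Lemma Cexp_inj (x y : C) :
  (Rabs (Im x - Im y) < 2 * PI)%R -> Cexp x = Cexp y -> x = y.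
Proof.
intros B E.
assert (E1 : Cexp (x - y) = 1).
{ unfold Cminus; rewrite Cexp_plus, E, Cmult_comm; apply Cexp_opp_l. }
set (d := x - y) in *.
assert (Bd : (Rabs (Im d) < 2 * PI)%R) by exact B.
apply Ceq_minus; fold d; clearbody d; clear B E.
destruct d as [a b]; simpl in Bd.
assert (Ere := f_equal Re E1); assert (Eim := f_equal Im E1); unfold Cexp in *; simpl in *.
assert (Ha := exp_pos a).
assert (Hc : (exp a * cos b = 1)%R) by lra.
assert (Hs : (exp a * sin b = 0)%R) by lra.
assert (Hsin : sin b = 0%R).
{ apply Rmult_integral in Hs; destruct Hs; lra. }
assert (Hcos : cos b = 1%R).
{ assert (T := sin2_cos2 b); rewrite Hsin in T; unfold Rsqr in T; nra. }
(* Halving brings the angle into (-PI, PI), where the sine vanishes only at 0. *)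
assert (Hb : sin (b / 2) = 0%R).
{ replace b with (2 * (b / 2))%R in Hcos by field; rewrite cos_2a_sin in Hcos; nra. }
assert (b = 0)%R.
{ apply Rabs_lt_between in Bd.
  destruct (Rtotal_order b 0) as [L | [L | L]]; [ | exact L | ].
  - assert (P : (0 < sin (- (b / 2)))%R) by (apply sin_gt_0; lra).
    rewrite sin_neg in P; lra.
  - assert (P : (0 < sin (b / 2))%R) by (apply sin_gt_0; lra); lra. }
subst b; rewrite Hcos, Rmult_1_r in Hc.
assert (a = 0)%R by (apply exp_inv; now rewrite exp_0).
subst a; reflexivity.
Qed.

(** The m-th term of the arcsine series is at most a_m / (2m + 1) <= a_m / (m + 1). The sharp
    constant would be PI / 2, but any bound below PI separates the branches. *)
Lemma Rabs_Re_ray_arcsin (w : C) : (Cmod w <= 1)%R -> (Rabs (Re (ray_arcsin w 1)) <= 2)%R.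
Proof.
intros Hw; destruct half_coef_series as [E L].
assert (B : forall m, (Cmod (w / 2 * prim_coef (1 / 2) (w ^ 2) m)
  <= half_coef m / (INR m + 1))%R).
{ intros m; assert (H := pos_INR m); assert (Ha := half_coef_pos m).
  assert (H2 := prim_coef_le (1 / 2) (w ^ 2) m ltac:(lra) (Cmod_sqr_le_1 w Hw)).
  assert (H0 := Cmod_ge_0 (prim_coef (1 / 2) (w ^ 2) m)).
  rewrite Cmod_mult, Cmod_div, Cmod_R, Rabs_pos_eq by (try apply RtoC_neq; lra).
  apply (Rle_trans _ (1 / 2 * (half_coef m / (INR m + 1 / 2)))%R).
  - apply Rmult_le_compat; [ | exact H0 | lra | exact H2].
    assert (H3 := Cmod_ge_0 w); lra.
  - replace (1 / 2 * (half_coef m / (INR m + 1 / 2)))%R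
      with (half_coef m * / (2 * INR m + 1))%R by (field; lra).
    apply Rmult_le_compat_l; [lra | apply Rinv_le_contravar; lra]. }
replace (ray_arcsin w 1) with (Cseries (fun m => w / 2 * prim_coef (1 / 2) (w ^ 2) m)).
{ eapply Rle_trans; [exact (Re_Cseries_le _ _ B E) | exact L]. }
rewrite Cseries_scal.
- unfold ray_arcsin, ray_prim, Cpseries.
  rewrite (Cseries_ext (fun m => prim_coef (INR 1 / 2) (w ^ 2) m * (1 ^ 2)%R ^ m)
    (prim_coef (1 / 2) (w ^ 2))).
  + simpl; unfold Cdiv; ring.
  + intros m; rewrite pow1, Cpow_1_l; simpl INR; ring.
- apply (Csummable_le _ (fun m => half_coef m / (INR m + 1 / 2))%R).
  + intros m; apply prim_coef_le; [lra | now apply Cmod_sqr_le_1].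
  + apply ex_series_half_coef_div; lra.
Qed.

(** The root is 1 minus half of a series bounded by 2. The estimate has no slack: the root is 0 at w
    = 1. *)
Lemma Re_ray_sqrt_nonneg (w : C) : (Cmod w <= 1)%R -> (0 <= Re (ray_sqrt w 1))%R.
Proof.
intros Hw; destruct half_coef_series as [E L].
assert (B : forall m, (Cmod (w ^ 2 * prim_coef 1 (w ^ 2) m)
  <= half_coef m / (INR m + 1))%R).
{ intros m.
  assert (H2 := prim_coef_le 1 (w ^ 2) m Rlt_0_1 (Cmod_sqr_le_1 w Hw)).
  assert (H3 := Cmod_sqr_le_1 w Hw); assert (H4 := Cmod_ge_0 (w ^ 2)).
  assert (H0 := Cmod_ge_0 (prim_coef 1 (w ^ 2) m)).
  rewrite Cmod_mult; nra. }
assert (R0 := Re_Cseries_le _ _ B E).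
replace (ray_sqrt w 1)
  with (1 - Cseries (fun m => w ^ 2 * prim_coef 1 (w ^ 2) m) * (/ 2)%R).
{ unfold Cminus; rewrite re_plus, re_opp, re_scal_r, re_RtoC.
  apply Rabs_le_between in R0; lra. }
rewrite Cseries_scal.
- unfold ray_sqrt, ray_prim, Cpseries.
  rewrite (Cseries_ext (fun m => prim_coef (INR 2 / 2) (w ^ 2) m * (1 ^ 2)%R ^ m)
    (prim_coef 1 (w ^ 2))).
  + rewrite RtoC_inv by lra; simpl; unfold Cdiv; ring.
  + intros m; rewrite pow1, Cpow_1_l; replace (INR 2 / 2)%R with 1%R by (simpl; field).
    ring.
- apply (Csummable_le _ (fun m => half_coef m / (INR m + 1))%R).
  + intros m; apply prim_coef_le; [exact Rlt_0_1 | now apply Cmod_sqr_le_1].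
  + exact E.
Qed.

(* The principal square root has nonnegative real part and [Re (1 - w ^ 2) >= 0], which
   identifies [ray_sqrt]; the logarithm is then determined because [2 < PI]. *)
Lemma Carcsin_ray_arcsin (w : C) : (Cmod w <= 1)%R -> Carcsin w = ray_arcsin w 1.
Proof.
intros Hw; unfold Carcsin.
rewrite <- (ray_sqrt_sqr w Hw), Csqrt_unique.
- rewrite Cplus_comm, <- (Cexp_ray_arcsin w Hw).
  replace (Clog (Cexp (Ci * ray_arcsin w 1))) with (Ci * ray_arcsin w 1).
  + transitivity (- (Ci * Ci) * ray_arcsin w 1); [ring | rewrite Ci2; ring].
  + apply Cexp_inj; [ | symmetry; apply Cexp_Clog, Cexp_neq_0].
    assert (B := Rabs_Re_ray_arcsin w Hw); assert (P := PI2_3_2).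
    assert (B2 := Carg_bounds (Cexp (Ci * ray_arcsin w 1))).
    replace (Im (Clog (Cexp (Ci * ray_arcsin w 1))))
      with (Carg (Cexp (Ci * ray_arcsin w 1))) by (unfold Clog; simpl; ring).
    replace (Im (Ci * ray_arcsin w 1)) with (Re (ray_arcsin w 1)) by (simpl; ring).
    apply Rabs_le_between in B; unfold PI2 in P; apply Rabs_lt_between; lra.
- apply Re_ray_sqrt_nonneg, Hw.
- rewrite (ray_sqrt_sqr w Hw).
  unfold Cminus; rewrite re_plus, re_opp, re_RtoC.
  assert (H1 := re_le_Cmod (w ^ 2)); assert (H2 := Cmod_sqr_le_1 w Hw).
  apply Rabs_le_between in H1; lra.
Qed.

(** * The hypergeometric series *)

Lemma pochhammer_pos (a : R) (m : nat) :
  (0 < a)%R -> exists p : R, (0 < p)%R /\ pochhammer a m = p.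
Proof.
intros Ha; induction m as [|m [p [Hp IH]]]; simpl.
- exists 1%R; split; [lra | reflexivity].
- exists (p * (a + INR m))%R; rewrite IH, RtoC_mult, RtoC_plus; split; [ | reflexivity].
  assert (H := pos_INR m); apply Rmult_lt_0_compat; lra.
Qed.

Lemma pochhammer_half (m : nat) : pochhammer (1 / 2) m = half_coef m * INR (fact m).
Proof.
induction m as [|m IH]; [simpl; ring | ].
simpl pochhammer; rewrite IH; change (fact (S m)) with (S m * fact m)%nat.
assert (H := pos_INR m).
rewrite mult_INR, S_INR; simpl half_coef.
rewrite !RtoC_mult, RtoC_div, !RtoC_plus, RtoC_div by lra.
field; cbv beta; rewrite <- RtoC_plus; apply RtoC_neq; lra.
Qed.

(** Both sides are b (b + 1) ... (b + m); hence (b)_m / (b + 1)_m = b / (m + b), the source of the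
    denominators in [prim_coef]. *)
Lemma pochhammer_shift (b : C) (m : nat) :
  pochhammer b m * (b + INR m) = b * pochhammer (b + 1) m.
Proof.
induction m as [|m IH]; [simpl; ring | ].
simpl pochhammer; rewrite IH, S_INR, RtoC_plus; ring.
Qed.

Lemma hyp2F1_half_term (b : R) (z : C) (m : nat) :
  (0 < b)%R -> hyp2F1_term (1 / 2) b (b + 1) z m = b * prim_coef b z m.
Proof.
intros Hb; unfold hyp2F1_term, prim_coef; rewrite pochhammer_half.
assert (H := pos_INR m).
destruct (pochhammer_pos (b + 1) m) as [p [Hp E]]; [lra | ].
assert (Hp1 : RtoC p <> 0) by (apply RtoC_neq; lra).
assert (HF : RtoC (INR (fact m)) <> 0) by apply RtoC_neq, INR_fact_neq_0.
assert (HB : INR m + b <> 0) by (rewrite <- RtoC_plus; apply RtoC_neq; lra).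
rewrite RtoC_plus in E.
generalize (pochhammer_shift b m); rewrite E, RtoC_div, RtoC_plus by lra.
intros P.
transitivity (half_coef m * (pochhammer b m * (b + INR m)) / p / (INR m + b) * z ^ m).
- field; repeat split; assumption.
- rewrite P; field; repeat split; assumption.
Qed.

Lemma hyp2F1_half (b : R) (z : C) :
  (0 < b)%R -> (Cmod z <= 1)%R ->
  hyp2F1 (1 / 2) b (b + 1) z = b * Cseries (prim_coef b z).
Proof.
intros Hb Hz; rewrite <- Cseries_scal.
- apply Cseries_ext; intros m; now apply hyp2F1_half_term.
- apply (Csummable_le _ (fun m => half_coef m / (INR m + b))%R).
  + intros m; now apply prim_coef_le.
  + now apply ex_series_half_coef_div.
Qed.

Lemma hyp2F1_half_cv (b : R) (z : C) :
  (0 < b)%R -> (Cmod z <= 1)%R -> hyp2F1_cv (1 / 2) b (b + 1) z.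
Proof.
intros Hb Hz; unfold hyp2F1_cv.
refine (ex_series_le (V := C_CompleteNormedModule) _
  (fun m => b * (half_coef m / (INR m + b)))%R _ _).
- intros m; rewrite hyp2F1_half_term by exact Hb.
  change (Cmod (b * prim_coef b z m) <= b * (half_coef m / (INR m + b)))%R.
  rewrite Cmod_mult, Cmod_R, Rabs_pos_eq by lra.
  apply Rmult_le_compat_l; [lra | now apply prim_coef_le].
- apply (ex_series_scal_l (K := R_AbsRing) (V := R_NormedModule)).
  now apply ex_series_half_coef_div.
Qed.

(** Without its constant term the series is z times a series bounded uniformly on the unit disc, and
    [M] is the sum of that majorant. The bounds are componentwise because balls in C are products of
    intervals. *)
Lemma hyp2F1_half_continuous_0 (b : R) :
  (0 < b)%R -> exists M : R, (0 <= M)%R /\ forall z, (Cmod z <= 1)%R ->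
    (Rabs (Re (hyp2F1 (1 / 2) b (b + 1) z - hyp2F1 (1 / 2) b (b + 1) 0)) <= Cmod z * M)%R /\
    (Rabs (Im (hyp2F1 (1 / 2) b (b + 1) z - hyp2F1 (1 / 2) b (b + 1) 0)) <= Cmod z * M)%R.
Proof.
intros Hb; set (B := (fun m => b * (half_coef (S m) / (INR (S m) + b)))%R).
assert (HB : ex_series B).
{ apply (ex_series_scal_l (K := R_AbsRing) (V := R_NormedModule)).
  apply (ex_series_incr_1 (fun m => half_coef m / (INR m + b))%R).
  now apply ex_series_half_coef_div. }
exists (Series B); split.
{ eapply Rle_trans; [apply Rabs_pos | ].
  apply (Rabs_Series_le (fun _ => 0%R)); [ | exact HB].
  intros m; rewrite Rabs_R0; apply Rmult_le_pos; [lra | ].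
  now apply Rlt_le, half_coef_div_pos. }
assert (D : forall z, (Cmod z <= 1)%R ->
  Csummable (prim_coef b z) /\ (forall m,
  (Cmod (b * prim_coef b z (S m)) <= Cmod z * B m)%R)).
{ intros z Hz; split.
  - apply (Csummable_le _ (fun m => half_coef m / (INR m + b))%R).
    + intros m; now apply prim_coef_le.
    + now apply ex_series_half_coef_div.
  - intros m; unfold B.
    replace (b * prim_coef b z (S m))
      with (z * (b * ((half_coef (S m) / (INR (S m) + b))%R * z ^ m)))
      by (unfold prim_coef; rewrite (Cpow_S z); ring).
    rewrite Cmod_mult, (Cmod_mult b), Cmod_R, Rabs_pos_eq by lra.
    apply Rmult_le_compat_l; [apply Cmod_ge_0 | ].
    apply Rmult_le_compat_l; [lra | ].
    apply Cmod_scal_pow_le; [now apply Rlt_le, half_coef_div_pos | exact Hz]. }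
assert (F : forall z, (Cmod z <= 1)%R -> hyp2F1 (1 / 2) b (b + 1) z =
  b * prim_coef b z 0 + Cseries (fun m => b * prim_coef b z (S m))).
{ intros z Hz; rewrite hyp2F1_half, Cseries_incr_1, Cseries_scal;
    [ring | | | exact Hb | exact Hz].
  - exact (Csummable_incr _ (proj1 (D z Hz))).
  - exact (proj1 (D z Hz)). }
assert (Z0 : (Cmod 0 <= 1)%R) by (rewrite Cmod_0; lra).
assert (F0 : hyp2F1 (1 / 2) b (b + 1) 0 = b * prim_coef b 0 0).
{ rewrite F by exact Z0.
  (* All these terms are zero; a visible factor 0 lets [Cseries_scal] evaluate the sum. *)
  rewrite (Cseries_ext _ (fun m => 0 * prim_coef b 0 (S m))).
  - rewrite Cseries_scal; [ring | exact (Csummable_incr _ (proj1 (D 0 Z0)))].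
  - intros m; unfold prim_coef; rewrite (Cpow_S 0); ring. }
intros z Hz; rewrite F0, F by exact Hz.
replace (b * prim_coef b z 0 + Cseries (fun m => b * prim_coef b z (S m))
  - b * prim_coef b 0 0) with (Cseries (fun m => b * prim_coef b z (S m)))
  by (unfold prim_coef; simpl; ring).
rewrite <- Series_scal_l.
assert (E : ex_series (fun m => Cmod z * B m)%R).
{ apply (ex_series_scal_l (K := R_AbsRing) (V := R_NormedModule)); exact HB. }
split; [apply Re_Cseries_le | apply Im_Cseries_le]; try exact E; apply D, Hz.
Qed.

Lemma is_value_rem0_hyp2F1_half (b : R) (f : C -> C) (z : C) :
  (0 < b)%R -> (Cmod z <= 1)%R ->
  (forall w : C, w <> 0 -> (Cmod w <= 1)%R -> hyp2F1 (1 / 2) b (b + 1) w = f w) ->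
  is_value_rem0 f z (hyp2F1 (1 / 2) b (b + 1) z).
Proof.
intros Hb Hz H; split; [intros Hz0; now apply H | intros ->].
destruct (hyp2F1_half_continuous_0 b Hb) as [M [HM L]].
intros P [eps HP].
assert (He := cond_pos eps).
(* A ball of radius d is a square, on which |w| <= sqrt 2 * d <= 2 d. The first bound keeps |w| <=
   1, the second makes 2 d M < eps; M + 1 is positive even if M is 0. *)
assert (Hd : (0 < Rmin (1 / 2) (eps / (2 * (M + 1))))%R).
{ apply Rmin_pos; [lra | apply Rdiv_lt_0_compat; lra]. }
exists (mkposreal _ Hd); intros w [Hw1 Hw2] Hw.
apply Rabs_lt_between in Hw1; apply Rabs_lt_between in Hw2.
unfold minus, plus, opp in Hw1, Hw2; simpl in Hw1, Hw2.
assert (R1 := Rmin_l (1 / 2) (eps / (2 * (M + 1)))).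
assert (R2 := Rmin_r (1 / 2) (eps / (2 * (M + 1)))).
set (d := Rmin (1 / 2) (eps / (2 * (M + 1)))) in *.
assert (Hm : (Cmod w <= 2 * d)%R).
{ apply (Rle_trans _ (sqrt 2 * Rmax (Rabs (fst w)) (Rabs (snd w)))%R);
    [apply Cmod_2Rmax | ].
  apply Rmult_le_compat; [apply sqrt_pos | | | ].
  - eapply Rle_trans; [apply Rabs_pos | apply Rmax_l].
  - rewrite <- (sqrt_square 2) at 2 by lra; apply sqrt_le_1; lra.
  - apply Rmax_lub; apply Rabs_le_between; lra. }
assert (Hb2 : (Cmod w * M < eps)%R).
{ apply (Rle_lt_trans _ (2 * d * M)%R); [now apply Rmult_le_compat_r | ].
  assert (2 * d * (M + 1) <= eps)%R; [ | nra].
  apply (Rmult_le_reg_r (/ (2 * (M + 1)))); [apply Rinv_0_lt_compat; lra | ].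
  replace (2 * d * (M + 1) * / (2 * (M + 1)))%R with d by (field; lra); exact R2. }
apply HP; rewrite <- H; [ | exact Hw | lra].
destruct (L w) as [L1 L2]; [lra | ].
split.
- exact (Rle_lt_trans _ _ _ L1 Hb2).
- exact (Rle_lt_trans _ _ _ L2 Hb2).
Qed.

(** One statement for both formulas: p = 2n gives the parameter 1/2 + n, and p = 2n + 1 gives 1 +
    n. *)
Lemma hyp2F1_ray_prim (p : nat) (w : C) :
  w <> 0 -> (Cmod w <= 1)%R ->
  hyp2F1 (1 / 2) (INR (S p) / 2)%R ((INR (S p) / 2)%R + 1) (w ^ 2) =
  INR (S p) / w ^ S p * ray_prim p w 1.
Proof.
intros Hw0 Hw; rewrite hyp2F1_half by (apply INR_S_half_pos || now apply Cmod_sqr_le_1).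
unfold ray_prim, Cpseries.
rewrite (Cseries_ext (fun m => prim_coef (INR (S p) / 2) (w ^ 2) m * (1 ^ 2)%R ^ m)
  (prim_coef (INR (S p) / 2) (w ^ 2))).
- rewrite RtoC_div, Cpow_1_l by lra.
  assert (N := Cpow_nz w (S p) Hw0); field; exact N.
- intros m; rewrite pow1, Cpow_1_l; ring.
Qed.

Theorem corollary1 : forall (n : nat) (z : C), (Cmod z <= 1)%R ->
  (hyp2F1_cv (1 / 2) (1 / 2 + INR n) (3 / 2 + INR n) z /\
   is_value_rem0
     (fun w : C =>
        (1 + 2 * INR n) / (4 ^ n * Csqrt w ^ (2 * n + 1)) *
        (Cbinom (2 * n) n * Carcsin (Csqrt w) +
         (-1) ^ n *
         Csum_except
           (fun k => (-1) ^ k * Cbinom (2 * n) k *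
              (Csin (2 * (INR n - INR k) * Carcsin (Csqrt w)) /
               (2 * (INR n - INR k)))) (2 * n) n))
     z (hyp2F1 (1 / 2) (1 / 2 + INR n) (3 / 2 + INR n) z)) /\
  (hyp2F1_cv (1 / 2) (1 + INR n) (2 + INR n) z /\
   is_value_rem0
     (fun w : C =>
        (-1) ^ (1 + n) * ((1 + INR n) / (4 ^ n * w ^ (1 + n))) *
        Csum
          (fun k => (-1) ^ k * Cbinom (1 + 2 * n) k *
             ((Ccos ((2 * INR n - 2 * INR k + 1) * Carcsin (Csqrt w)) - 1) /
              (2 * INR n - 2 * INR k + 1))) (1 + 2 * n))
     z (hyp2F1 (1 / 2) (1 + INR n) (2 + INR n) z)) /\
  Csum
    (fun k => (-1) ^ k * Cbinom (1 + 2 * n) k *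
       (Csin ((2 * INR n - 2 * INR k + 1) * Carcsin (Csqrt z)) /
        (2 * INR n - 2 * INR k + 1))) (1 + 2 * n) = 0 /\
  Csum_except
    (fun k => (-1) ^ k * Cbinom (2 * n) k *
       ((1 - Ccos (2 * (INR n - INR k) * Carcsin (Csqrt z))) /
        (INR n - INR k))) (2 * n) n = 0.
Proof.
intros n z Hz.
assert (Hn := pos_INR n).
assert (N4 : 4 ^ n <> 0) by (apply Cpow_nz, RtoC_neq; lra).
assert (Nm : (-1) ^ n <> 0) by (apply Cpow_nz, RtoC_neq; lra).
assert (S0 : forall w : C, w <> 0 -> Csqrt w <> 0).
{ intros w Hw E; apply Hw; rewrite <- (Csqrt_sqr w), E; ring. }
split; [ | split; [ | split; [apply sine_sum_0 | apply cosine_sum_0]]].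
- replace (1 / 2 + INR n) with (RtoC (INR (S (2 * n)) / 2)).
  2:{ rewrite S_INR, mult_INR, RtoC_div, RtoC_plus, RtoC_mult by lra.
      change (INR 2) with 2%R; field. }
  replace (3 / 2 + INR n) with ((INR (S (2 * n)) / 2)%R + 1).
  2:{ rewrite S_INR, mult_INR, RtoC_div, RtoC_plus, RtoC_mult by lra.
      change (INR 2) with 2%R; field. }
  split; [apply hyp2F1_half_cv; [apply INR_S_half_pos | exact Hz] | ].
  apply is_value_rem0_hyp2F1_half; [apply INR_S_half_pos | exact Hz | ].
  intros w Hw Hw1; rewrite <- (Csqrt_sqr w) at 1.
  assert (Hs := Cmod_Csqrt w Hw1).
  rewrite hyp2F1_ray_prim by auto.
  fold (sin_even_prim n (Carcsin (Csqrt w))).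
  rewrite (Carcsin_ray_arcsin _ Hs), (sin_even_prim_ray_arcsin n _ Hs).
  replace (2 * n + 1)%nat with (S (2 * n)) by lia.
  rewrite S_INR, mult_INR, RtoC_plus, RtoC_mult; change (INR 2) with 2%R.
  assert (Np := Cpow_nz _ (S (2 * n)) (S0 w Hw)); field; split; assumption.
- replace (1 + INR n) with (RtoC (INR (S (2 * n + 1)) / 2)).
  2:{ rewrite S_INR, plus_INR, mult_INR, RtoC_div, !RtoC_plus, RtoC_mult by lra.
      change (INR 2) with 2%R; change (INR 1) with 1%R; field. }
  replace (2 + INR n) with ((INR (S (2 * n + 1)) / 2)%R + 1).
  2:{ rewrite S_INR, plus_INR, mult_INR, RtoC_div, !RtoC_plus, RtoC_mult by lra.
      change (INR 2) with 2%R; change (INR 1) with 1%R; field. }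
  split; [apply hyp2F1_half_cv; [apply INR_S_half_pos | exact Hz] | ].
  apply is_value_rem0_hyp2F1_half; [apply INR_S_half_pos | exact Hz | ].
  intros w Hw Hw1; rewrite <- (Csqrt_sqr w) at 1.
  assert (Hs := Cmod_Csqrt w Hw1).
  rewrite hyp2F1_ray_prim by auto.
  fold (sin_odd_prim n (Carcsin (Csqrt w))).
  rewrite (Carcsin_ray_arcsin _ Hs), (sin_odd_prim_ray_arcsin n _ Hs).
  (* The exponent 2n + 2 is even, so the square root disappears from the prefactor. *)
  replace (Csqrt w ^ S (2 * n + 1)) with (w ^ (1 + n)).
  2:{ rewrite <- (Csqrt_sqr w) at 1; rewrite <- Cpow_mult_r; f_equal; lia. }
  assert (Np := Cpow_nz _ (1 + n) Hw).
  rewrite (Cpow_add_r (-1)), Cpow_1_r, RtoC_div by lra.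
  (* The sign (-1)^(1+n) meets the factor -(-1)^n from [sin_odd_prim_ray_arcsin]; what remains is
     the square of (-1)^n. *)
  transitivity ((-1) ^ n * (-1) ^ n * (INR (S (2 * n + 1)) / w ^ (1 + n)
    * ray_prim (2 * n + 1) (Csqrt w) 1)).
  + rewrite <- Cpow_add_r; replace (n + n)%nat with (2 * n)%nat by lia.
    rewrite Cpow_m1_double; ring.
  + field; split; assumption.
Qed.
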